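(* Let $m\ge1$, $n\ge 1$ be integers, let $a_1,\dots,a_{2n}\ge1$ be integers, and let $G=\overline{\mathcal G}[a_1,a_2,\dots,a_{2n-1},a_{2n}]$ be the corresponding planar band graph. Consider the set of good $m$-dimer covers of $G$, with the poset structure whose cover relations are the up-flips around the square faces of $G$ (up-flips around the interior face are not allowed). This poset is a distributive lattice.
   Context: **Snake graphs.** Let $a_1,\dots,a_k\ge 1$ be integers, $N=a_1+\dots+a_k$. The snake graph $\mathcal G[a_1,\dots,a_{k-1},a_k+1]$ is the planar graph (subgraph of the grid $\mathbb Z^2$) formed by the vertices and edges of $N$ unit square tiles $T_1,\dots,T_N$ as follows. The tiles are grouped consecutively into $k$ blocks, the $i$-th block having $a_i$ tiles. $T_1$ has lower-left corner $(0,0)$. Define directions $d_0,d_1,\dots,d_N\in\{\text{North},\text{East}\}$ by $d_0=\text{North}$ and, for $1\le i\le N$: $d_i\neq d_{i-1}$ if $T_i$ is not the last tile of its block, and $d_i=d_{i-1}$ if $T_i$ is the last tile of its block. For $1\le i<N$, $T_{i+1}$ is the translate of $T_i$ by one unit in direction $d_i$. Vertices $(x,y)$ are colored black if $x+y$ is even and white otherwise. Let $a=(0,0)$ (black), $b=(1,0)$ (white) be the endpoints of the south edge of $T_1$. Let the exit edge be the north edge of $T_N$ if $d_N$ is North and the east edge of $T_N$ if $d_N$ is East; $a'$ denotes its black endpoint and $b'$ its white endpoint. **Band graphs.** For $a_1,\dots,a_{2n}\ge1$, the band graph $\overline{\mathcal G}[a_1,\dots,a_{2n}]$ is obtained from the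 snake graph $\mathcal G[a_1,\dots,a_{2n-1},a_{2n}+1]$ by gluing the edge $(ab)$ to the edge $(a'b')$ with $a$ identified with $a'$ and $b$ with $b'$ (parallel edges, if any arise, are kept distinct). It is a planar bipartite graph: the glued tiles form an annulus. Its square faces are the images of the tiles $T_1,\dots,T_N$. Besides these it has the interior face $f_0$, whose boundary is the image of the south-facing and east-facing boundary edges of the snake graph (other than the glued edge), and the exterior (unbounded) face $f_\infty$, whose boundary is the image of the north-facing and west-facing boundary edges (other than the glued edge). **Good matchings and good $m$-dimer covers.** Let $P$ be a perfect matching of the underlying snake graph $\mathcal G[a_1,\dots,a_{2n-1},a_{2n}+1]$ containing at least one of $(ab)$, $(a'b')$. If $P$ contains exactly one of them, remove it and take the image of the remaining edges in the band graph; if $P$ contains both, take the image of $P$, with the glued edge included once. The perfect matchings of the band graph obtained this way are the good matchings. A good $m$-dimer cover is a multiset $M$ of edges of the band graph with multiplicity function $\operatorname{mult}_M=\sum_{i=1}^m\operatorname{mult}_{P_i}$ for some (not necessarily distinct) good matchings $P_1,\dots,P_m$, where $\operatorname{mult}_{P_i}$ is the indicator function of $P_i$. **Up-flip around a square face.** Let $f$ be (the image of) a tile with its four sides listed and oriented clockwise (in the plane in which the tile is drawn) as $e_1,e_2,e_3,e_4$, with $e_2,e_4$ oriented from white to black and $e_1,e_3$ from black to white. If $\operatorname{mult}_M(e_2),\operatorname{mult}_M(e_4)\ge1$, the up-flip of $M$ around $f$ decreases the multiplicities of $e_2,e_4$ by $1$, increases those of $e_1,e_3$ by $1$, and leaves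 all others unchanged. In the poset, $M\le M'$ if $M'$ can be obtained from $M$ by a (possibly empty) sequence of such up-flips. *)

(* Defs.v *)
From HB Require Import structures.
From mathcomp Require Import all_boot all_order.

Set Implicit Arguments.
Unset Strict Implicit.
Unset Printing Implicit Defensive.

(* A finite multigraph: [ends e v] says that [v] is an endpoint of [e], so
   distinct edges may have the same endpoints. *)
Record multigraph := Multigraph {
  vertex : finType;
  edge : finType;
  ends : edge -> pred vertex
}.

Definition perfect_matching (G : multigraph) (P : {set edge G}) : bool :=
  [forall v : vertex G, #|[set e in P | ends e v]| == 1].

(* All coordinates that occur are nonnegative, so the grid is [nat * nat]. *)
Definition point : Type := (nat * nat)%type.

Definition direction : Type := bool.
Definition North : direction := true.
Definition East : direction := false.

Definition step (d : direction) (p : point) : point :=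
  if d == North then (p.1, p.2.+1) else (p.1.+1, p.2).

(* [(p, d)] is the unit edge from [p] to [step d p]. *)
Definition grid_edge : Type := (point * direction)%type.

Definition endpoints (e : grid_edge) : seq point := [:: e.1; step e.2 e.1].

Definition black (p : point) : bool := ~~ odd (p.1 + p.2).

Definition black_end (e : grid_edge) : point :=
  if black e.1 then e.1 else step e.2 e.1.
Definition white_end (e : grid_edge) : point :=
  if black e.1 then step e.2 e.1 else e.1.

(* The sides of the unit square with lower-left corner [p]. *)
Definition west_side (p : point) : grid_edge := (p, North).
Definition north_side (p : point) : grid_edge := (step North p, East).
Definition east_side (p : point) : grid_edge := (step East p, North).
Definition south_side (p : point) : grid_edge := (p, East).

(* The sides in clockwise order, each paired with its starting vertex for the
   clockwise orientation. *)
Definition clockwise_sides (p : point) : seq (point * grid_edge) :=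
  [:: (p, west_side p);
      (step North p, north_side p);
      (step North (step East p), east_side p);
      (step East p, south_side p)].

Definition sides (p : point) : seq grid_edge :=
  [seq s.2 | s <- clockwise_sides p].
Definition corners (p : point) : seq point :=
  [seq s.1 | s <- clockwise_sides p].

(* The sides oriented from white to black, resp. from black to white. *)
Definition white_to_black (p : point) : seq grid_edge :=
  [seq s.2 | s <- clockwise_sides p & ~~ black s.1].
Definition black_to_white (p : point) : seq grid_edge :=
  [seq s.2 | s <- clockwise_sides p & black s.1].

Definition num_tiles (a : seq nat) : nat := sumn a.

(* The partial sums a_1, a_1 + a_2, ...: the (1-based) indices of the last
   tiles of the blocks. *)
Definition block_ends (a : seq nat) : seq nat := scanl addn 0 a.

(* [dir a i] is d_i. *)
Fixpoint dir (a : seq nat) (i : nat) : direction :=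
  if i is j.+1 then
    if i \in block_ends a then dir a j else ~~ dir a j
  else North.

(* [tile a i] is the lower-left corner of T_(i+1): tiles are numbered from 0
   here, so T_(i+2) is T_(i+1) moved in direction d_(i+1). *)
Fixpoint tile (a : seq nat) (i : nat) : point :=
  if i is j.+1 then step (dir a i) (tile a j) else (0, 0).

Definition tiles (a : seq nat) : seq point := mkseq (tile a) (num_tiles a).

Definition snake_points (a : seq nat) : seq point :=
  flatten [seq corners p | p <- tiles a].
Definition snake_grid_edges (a : seq nat) : seq grid_edge :=
  flatten [seq sides p | p <- tiles a].

(* For [a = [:: a_1; ...; a_k]] this is G[a_1, ..., a_(k-1), a_k + 1]. *)
Definition snake_graph (a : seq nat) : multigraph :=
  @Multigraph (seq_sub (snake_points a)) (seq_sub (snake_grid_edges a))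
    (fun e v => val v \in endpoints (val e)).

(* The edges (ab) and (a'b'). *)
Definition entry_edge : grid_edge := south_side (0, 0).
Definition exit_edge (a : seq nat) : grid_edge :=
  let p := tile a (num_tiles a).-1 in
  if dir a (num_tiles a) == North then north_side p else east_side p.

(* Gluing: a', b' and (a'b') are represented by a, b and (ab). *)
Definition glue_point (a : seq nat) (v : point) : point :=
  if v == black_end (exit_edge a) then black_end entry_edge
  else if v == white_end (exit_edge a) then white_end entry_edge
  else v.
Definition glue_edge (a : seq nat) (e : grid_edge) : grid_edge :=
  if e == exit_edge a then entry_edge else e.

(* Only (ab) and (a'b') are identified as edges: edges that become parallel
   remain distinct elements of the edge type. *)
Definition band_graph (a : seq nat) : multigraph :=
  @Multigraph (seq_sub [seq glue_point a v | v <- snake_points a])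
    (seq_sub [seq glue_edge a e | e <- snake_grid_edges a])
    (fun e v => val v \in [seq glue_point a u | u <- endpoints (val e)]).

Definition glue (a : seq nat) (e : edge (snake_graph a)) :
    edge (band_graph a) :=
  SeqSub (map_f (glue_edge a) (valP e)).

Definition has_edge (a : seq nat) (P : {set edge (snake_graph a)})
    (e : grid_edge) : bool :=
  [exists f in P, val f == e].

Definition matching_image (a : seq nat) (P : {set edge (snake_graph a)}) :
    {set edge (band_graph a)} :=
  if has_edge P entry_edge && has_edge P (exit_edge a) then @glue a @: P
  else @glue a @: [set e in P | val e \notin [:: entry_edge; exit_edge a]].

Definition good_matching (a : seq nat) (Q : {set edge (band_graph a)}) : bool :=
  perfect_matching Q &&
  [exists P : {set edge (snake_graph a)},
     [&& perfect_matching P,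
         has_edge P entry_edge || has_edge P (exit_edge a) &
         Q == matching_image P]].

(* A multiset of edges of the band graph is its multiplicity function. *)
Definition edge_multiset (a : seq nat) : Type :=
  {ffun edge (band_graph a) -> nat}.

Definition is_good_cover (a : seq nat) (m : nat) (M : edge_multiset a) : bool :=
  [exists Q : {ffun 'I_m -> {set edge (band_graph a)}},
     [forall i, good_matching (Q i)] &&
     [forall e, M e == \sum_(i < m) nat_of_bool (e \in Q i)]].

Definition good_cover (a : seq nat) (m : nat) : Type :=
  {M : {ffun edge (band_graph a) -> nat} | @is_good_cover a m M}.

(* [M'] is the up-flip of [M] around the image of the tile with lower-left
   corner [p]. *)
Definition up_flip_around (a : seq nat) (p : point) (M M' : edge_multiset a) :
    bool :=
  let down := [seq glue_edge a e | e <- white_to_black p] in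
  let up := [seq glue_edge a e | e <- black_to_white p] in
  [forall e : edge (band_graph a), (val e \in down) ==> (1 <= M e)] &&
  [forall e : edge (band_graph a),
     M' e == M e - nat_of_bool (val e \in down) + nat_of_bool (val e \in up)].

Definition up_flip (a : seq nat) (m : nat) : rel (good_cover a m) :=
  fun M M' => has (fun p => up_flip_around p (val M) (val M')) (tiles a).

Definition flip_le (a : seq nat) (m : nat) (M M' : good_cover a m) : Prop :=
  exists s : seq (good_cover a m), path (@up_flip a m) M s /\ last M s = M'.

Definition is_cover_relation (T : Type) (le : T -> T -> Prop) (r : rel T) :
    Prop :=
  forall x y : T, r x y <->
    [/\ le x y, x <> y & forall z, le x z -> le z y -> z = x \/ z = y].

(* [T] ordered by [le] is a distributive lattice: it is isomorphic, as an
   ordered type, to one of the library's distributive lattices. *)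
Definition is_distributive_lattice (T : Type) (le : T -> T -> Prop) : Prop :=
  exists (d : Order.disp_t) (L : distrLatticeType d) (f : L -> T),
    bijective f /\ forall x y : L, (x <= y)%O <-> le (f x) (f y).

(* Main.v *)
Require Import Defs.
From HB Require Import structures.
From mathcomp Require Import all_boot all_order.
From mathcomp Require Import zify.

Import Order.TTheory.

Set Implicit Arguments.
Unset Strict Implicit.
Unset Printing Implicit Defensive.

(** The tile [tile a k] is the only one on the antidiagonal [x + y = k], so the
    tiles form a chain, closed up to a cycle by the gluing.  Give each tile of
    a good cover [M] a height [h k] between [0] and [m]: the number of the [m]
    good matchings in which the tile has been flipped up, starting from the
    matching that consists of the boundary edges oriented from white to black.
    A tile excludes its black-to-white sides before it is flipped and its
    white-to-black sides afterwards, and the multiplicity of an edge [e] turns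
    out to be

      m - (sum of m - h k over the tiles k with e as a black-to-white side)
        - (sum of h k over the tiles k with e as a white-to-black side).

    An edge on the boundary lies on one tile and gives back the height of that
    tile, so [h] is determined by [M].  An edge between two consecutive tiles
    has opposite orientations around them, so its multiplicity is the difference
    of their heights; it is nonnegative exactly when the two heights compare in
    the direction prescribed by the edge.  Heights are thus the maps to
    [{0, ..., m}] that are monotone for a relation [fence] on the cycle of tiles
    ([band_drop_le]).  Conversely a monotone map is the sum of its threshold
    functions, each of which is the height function of a good matching; hence
    good covers and monotone maps correspond ([good_coverP]).  The condition
    that a good matching contains one of the two edges that are glued is the
    part of monotonicity that concerns the glued edge ([good_matchingP]).

    Monotone maps are closed under pointwise minimum and maximum and so form a
    distributive lattice.  An up-flip adds [1] to the height of one tile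
    ([up_flip_heights]), so it remains to see that a monotone [h] below a
    monotone [g] is joined to [g] by such steps through monotone maps.  This
    holds because the fence has no directed cycle: among the tiles where [h] is
    below [g], one of maximal rank can be raised ([monotone_raise]).  The
    comparisons change direction exactly at the ends of the blocks.  The number
    of blocks is even, which makes the glued edge compare the first tile with
    the last one; and there are at least two of them, so the comparisons do not
    all have the same direction around the cycle ([fence_rankP]). *)

(** * Monotone maps to an initial segment of the naturals *)

Definition is_monotone (I : finType) (R : rel I) (m : nat)
    (h : {ffun I -> 'I_m.+1}) : bool :=
  [forall i, forall j, R i j ==> (h i <= h j)].

Definition monotone_map (I : finType) (R : rel I) (m : nat) : Type :=
  {h : {ffun I -> 'I_m.+1} | is_monotone R h}.

HB.instance Definition _ (I : finType) (R : rel I) (m : nat) :=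
  SubChoice.on (monotone_map R m).

Lemma monotone_mapP (I : finType) (R : rel I) (m : nat)
    (h : {ffun I -> 'I_m.+1}) :
  reflect (forall i j, R i j -> h i <= h j) (is_monotone R h).
Proof.
apply: (iffP forallP) => mono_h i; last first.
  by apply/forallP => j; apply/implyP; apply: mono_h.
by move=> j; have /forallP/(_ j)/implyP := mono_h i.
Qed.

Lemma leq_ordE (n : nat) (i j : 'I_n) : (i <= j) = (i <= j)%O.
Proof. by []. Qed.

Fact monotone_meet_subproof (I : finType) (R : rel I) (m : nat)
    (h g : monotone_map R m) :
  is_monotone R [ffun k => Order.min (val h k) (val g k)].
Proof.
apply/monotone_mapP => i j Rij; rewrite !ffunE leq_ordE le_min.
rewrite !ge_min -!leq_ordE.
by rewrite (monotone_mapP _ _ (valP h)) //= (monotone_mapP _ _ (valP g)) ?orbT.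
Qed.

Fact monotone_join_subproof (I : finType) (R : rel I) (m : nat)
    (h g : monotone_map R m) :
  is_monotone R [ffun k => Order.max (val h k) (val g k)].
Proof.
apply/monotone_mapP => i j Rij; rewrite !ffunE leq_ordE ge_max.
rewrite !le_max -!leq_ordE.
by rewrite (monotone_mapP _ _ (valP h)) //= (monotone_mapP _ _ (valP g)) ?orbT.
Qed.

Definition monotone_meet (I : finType) (R : rel I) (m : nat)
    (h g : monotone_map R m) : monotone_map R m :=
  Sub _ (monotone_meet_subproof h g).

Definition monotone_join (I : finType) (R : rel I) (m : nat)
    (h g : monotone_map R m) : monotone_map R m :=
  Sub _ (monotone_join_subproof h g).

Definition monotone_le (I : finType) (R : rel I) (m : nat) :
    rel (monotone_map R m) :=
  fun h g => [forall i, val h i <= val g i].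

Lemma monotone_map_eqP (I : finType) (R : rel I) (m : nat)
    (h g : monotone_map R m) : (forall i, val h i = val g i) -> h = g.
Proof. by move=> eq_hg; apply/val_inj/ffunP. Qed.

Section MonotoneLattice.
Variables (I : finType) (R : rel I) (m : nat).
Implicit Types h g f : monotone_map R m.

Fact monotone_le_def h g : monotone_le h g = (monotone_meet h g == h).
Proof.
apply/forallP/eqP => [le_hg|<- i]; last first.
  by rewrite ffunE leq_ordE ge_min !lexx orbT.
by apply: monotone_map_eqP => i; rewrite ffunE min_l -?leq_ordE.
Qed.

Fact monotone_meetC : commutative (@monotone_meet I R m).
Proof. by move=> h g; apply: monotone_map_eqP => i; rewrite !ffunE minC. Qed.

Fact monotone_joinC : commutative (@monotone_join I R m).
Proof. by move=> h g; apply: monotone_map_eqP => i; rewrite !ffunE maxC. Qed.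

Fact monotone_meetA : associative (@monotone_meet I R m).
Proof. by move=> h g f; apply: monotone_map_eqP => i; rewrite !ffunE minA. Qed.

Fact monotone_joinA : associative (@monotone_join I R m).
Proof. by move=> h g f; apply: monotone_map_eqP => i; rewrite !ffunE maxA. Qed.

Fact monotone_joinKI g h : monotone_meet h (monotone_join h g) = h.
Proof. by apply: monotone_map_eqP => i; rewrite !ffunE maxKx. Qed.

Fact monotone_meetKU g h : monotone_join h (monotone_meet h g) = h.
Proof. by apply: monotone_map_eqP => i; rewrite !ffunE minKx. Qed.

Fact monotone_meetUl :
  left_distributive (@monotone_meet I R m) (@monotone_join I R m).
Proof.
by move=> h g f; apply: monotone_map_eqP => i; rewrite !ffunE min_maxl.
Qed.

Fact monotone_meetxx : idempotent_op (@monotone_meet I R m).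
Proof. by move=> h; apply: monotone_map_eqP => i; rewrite !ffunE minxx. Qed.

End MonotoneLattice.

HB.instance Definition _ (I : finType) (R : rel I) (m : nat) :=
  @Order.isMeetJoinDistrLattice.Build (Order.Disp tt tt) (monotone_map R m)
    (@monotone_le I R m) _ _ _ (@monotone_le_def I R m) (fun _ _ => erefl)
    (@monotone_meetC I R m) (@monotone_joinC I R m)
    (@monotone_meetA I R m) (@monotone_joinA I R m)
    (@monotone_joinKI I R m) (@monotone_meetKU I R m)
    (@monotone_meetUl I R m) (@monotone_meetxx I R m).

Definition reachable (T : eqType) (r : rel T) (x y : T) : Prop :=
  exists s : seq T, path r x s /\ last x s = y.

(** Among the points where [h] is below [g], raise one of maximal rank.  Raising
    [i] could only violate [R i k] for some [k] with [h k = h i]; but then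
    [h k < g i <= g k], and [k] would have been a point of larger rank. *)
Lemma monotone_raise (I : finType) (R : rel I) (m : nat) (rank : I -> nat)
    (rankP : forall i j, R i j -> rank i < rank j) (h g : monotone_map R m) :
  monotone_le h g -> h != g ->
  exists f : monotone_map R m, exists i : I,
    (forall j, val f j = val h j + (j == i) :> nat) /\ monotone_le f g.
Proof.
move=> /forallP le_hg neq_hg.
have [i0 lt_i0] : exists i, val h i < val g i.
  apply/existsP; apply: contraNT neq_hg; rewrite negb_exists => /forallP nlt.
  apply/eqP/monotone_map_eqP => i; apply/val_inj/eqP.
  by rewrite eqn_leq le_hg leqNgt nlt.
case: (@arg_maxnP _ i0 (fun i => val h i < val g i) rank) => // i lt_i max_i.
have bound j : val h j + (j == i) < m.+1.
  apply: leq_ltn_trans (ltn_ord (val g j)).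
  by have := le_hg j; case: eqP => [->|_]; rewrite ?addn1 ?addn0.
pose f := [ffun j => Ordinal (bound j)].
have mono_f : is_monotone R f.
  apply/monotone_mapP => j k Rjk; rewrite !ffunE /=.
  have hjk := monotone_mapP _ _ (valP h) _ _ Rjk.
  case: (j =P i) => [eq_ji|_]; last first.
    by rewrite addn0; apply: leq_trans hjk (leq_addr _ _).
  have [lt_k|] := ltnP (val h k) (val g k).
    have := max_i _ lt_k; rewrite -eq_ji => le_kj.
    by have := rankP _ _ Rjk; rewrite /= in le_kj *; lia.
  move=> ge_k; have gjk := monotone_mapP _ _ (valP g) _ _ Rjk.
  rewrite -eq_ji in lt_i *; rewrite addn1; apply: leq_trans (leq_addr _ _).
  exact: leq_trans lt_i (leq_trans gjk ge_k).
exists (Sub f mono_f), i; split=> [j|]; first by rewrite ffunE.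
apply/forallP => j; rewrite /= ffunE /=.
by have := le_hg j; case: eqP => [->|_]; rewrite ?addn1 ?addn0.
Qed.

(** The interface between the combinatorics of covers and the lattice: a graph
    [r] whose vertices are labelled bijectively by monotone maps, and whose
    arrows are the additions of [1] to one value, inherits the pointwise order
    of the maps as its reachability order. *)
Lemma raise_lattice (T : choiceType) (r : rel T) (I : finType) (R : rel I)
    (m : nat) (rank : I -> nat) (h : T -> monotone_map R m) :
    (forall i j, R i j -> rank i < rank j) ->
    injective h -> (forall g, exists x, h x = g) ->
    (forall x y, r x y <->
       exists i, forall j, val (h y) j = val (h x) j + (j == i) :> nat) ->
  is_cover_relation (reachable r) r /\ is_distributive_lattice (reachable r).
Proof.
move=> rankP h_inj h_onto rP.
have r_le x y : r x y -> monotone_le (h x) (h y).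
  by case/rP=> i Dy; apply/forallP=> j; rewrite Dy leq_addr.
have mle_trans x y z : monotone_le x y -> monotone_le y z -> monotone_le x z.
  move=> /forallP le_xy /forallP le_yz; apply/forallP => i.
  exact: leq_trans (le_xy i) (le_yz i).
have reach_le x y : reachable r x y -> monotone_le (h x) (h y).
  case=> s [path_s <-]; elim: s x path_s => [|z s IHs] x /=.
    by move=> _; apply/forallP.
  by case/andP=> /r_le rxz /IHs; apply: mle_trans.
have le_reach x y : monotone_le (h x) (h y) -> reachable r x y.
  (* Each raise lowers the total distance to [h y]. *)
  have [n] := ubnP (\sum_i (val (h y) i - val (h x) i)).
  elim: n x => // n IHn x le_n le_xy.
  have [eq_xy|neq_xy] := eqVneq (h x) (h y).
    by exists [::]; split=> //; apply: h_inj.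
  have [f [i [Df le_fy]]] := monotone_raise rankP le_xy neq_xy.
  have [z Dz] := h_onto f.
  rewrite -Dz in Df le_fy.
  have /IHn : \sum_i (val (h y) i - val (h z) i) < n.
    rewrite (bigD1 i) //= (eq_bigr (fun j => val (h y) j - val (h x) j)).
      have /forallP/(_ i) := le_fy.
      rewrite (bigD1 i) //= in le_n; move: le_n; rewrite Df eqxx /=.
      by move: (\sum_(_ | _) _) => S; lia.
    by move=> j /negPf neq_ji; rewrite Df neq_ji addn0.
  case=> // s [path_s last_s]; exists (z :: s); split=> //=.
  by rewrite path_s andbT; apply/rP; exists i.
split=> [x y|].
  split=> [rxy|[[[|z s] [/=]]]].
  - split; first by exists [:: y]; rewrite /= rxy.
      move=> eq_xy; case/rP: rxy => i /(_ i); rewrite eq_xy eqxx; lia.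
    move=> z /reach_le/forallP le_xz /reach_le/forallP le_zy.
    case/rP: rxy => i Dy.
    have [eq_i|neq_i] := eqVneq (val (h z) i) (val (h x) i); [left|right].
      apply/h_inj/monotone_map_eqP => j; apply/val_inj/eqP => /=.
      have [->|/negPf neq_ji] := eqVneq j i; first by rewrite eq_i.
      have := le_xz j; have := le_zy j; rewrite Dy neq_ji addn0 => le_zx le_xz'.
      by rewrite eqn_leq le_zx.
    apply/h_inj/monotone_map_eqP => j; apply/val_inj/eqP => /=.
    have := le_xz j; have := le_zy j; rewrite Dy.
    have [->|/negPf neq_ji] := eqVneq j i => le_zx le_xz';
      rewrite eqn_leq le_zx /=.
      by rewrite addn1 ltn_neqAle eq_sym neq_i.
    by rewrite addn0.
  - by move=> _ ->.
  - case/andP=> rxz path_s last_s neq_xy between.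
    have le_xz : reachable r x z by exists [:: z]; rewrite /= rxz.
    have le_zy : reachable r z y by exists s.
    case: (between z le_xz le_zy) => [eq_zx|<- //].
    by case/rP: rxz => i /(_ i); rewrite eq_zx eqxx; lia.
have ex_inv g : exists x, h x == g by have [x <-] := h_onto g; exists x.
exists _, (monotone_map R m), (fun g => xchoose (ex_inv g)); split.
  exists h => [g|x]; first exact/eqP/(xchooseP (ex_inv g)).
  by apply/h_inj/eqP/(xchooseP (ex_inv (h x))).
move=> x y.
rewrite -{1}(eqP (xchooseP (ex_inv x))) -{1}(eqP (xchooseP (ex_inv y))).
by split=> [/le_reach|/reach_le].
Qed.

(** * The chain of tiles *)

Local Arguments dir : simpl never.
Local Arguments tile : simpl never.
Local Arguments step : simpl never.

(** Tiles, and the starting points of edges, are told apart by their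
    antidiagonal. *)
Definition level (p : point) : nat := p.1 + p.2.

Lemma level_step (d : direction) (p : point) : level (step d p) = (level p).+1.
Proof. by case: d; rewrite /level /step /= ?addnS ?addSn. Qed.

Lemma tileS (a : seq nat) (k : nat) :
  tile a k.+1 = step (dir a k.+1) (tile a k).
Proof. by []. Qed.

Lemma level_tile (a : seq nat) (k : nat) : level (tile a k) = k.
Proof. by elim: k => // k IHk; rewrite tileS level_step IHk. Qed.

Lemma tile_inj (a : seq nat) : injective (tile a).
Proof. exact: can_inj (level_tile a). Qed.

Lemma stepC (d d' : direction) (p : point) :
  step d (step d' p) = step d' (step d p).
Proof. by case: d; case: d'. Qed.

Lemma eq_step (d d' : direction) (p : point) :
  (step d p == step d' p) = (d == d').
Proof.
by case: p => x y; case: d; case: d'; rewrite /step /= xpair_eqE ?eqxx //;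
  apply/negbTE; lia.
Qed.

Lemma mem_sides (p : point) (e : grid_edge) :
  (e \in sides p) = (e.1 == p) || (e.1 == step (~~ e.2) p).
Proof.
case: p e => x y [[z t] []]; rewrite !inE !xpair_eqE /= ?andbT ?andbF ?orbF /=.
all: lia.
Qed.

(** A clockwise turn runs through parallel sides in opposite directions, and the
    starting points of these two runs lie on diagonally opposite corners, which
    have the same color: parallel sides are of the same kind. *)
Lemma mem_black_to_white (p : point) (e : grid_edge) :
  (e \in black_to_white p) = (e \in sides p) && (e.2 (+) odd (level p)).
Proof.
rewrite mem_sides /level; case: p e => x y [[z t] d].
rewrite /black_to_white /clockwise_sides /= /black /= ?addnS ?addSn /= ?negbK.
by case: (odd (x + y)); case: d;
  rewrite /= !inE !xpair_eqE /= ?andbT ?andbF ?orbF // orbC.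
Qed.

Lemma mem_white_to_black (p : point) (e : grid_edge) :
  (e \in white_to_black p) = (e \in sides p) && ~~ (e.2 (+) odd (level p)).
Proof.
rewrite mem_sides /level; case: p e => x y [[z t] d].
rewrite /white_to_black /clockwise_sides /= /black /= ?addnS ?addSn /= ?negbK.
by case: (odd (x + y)); case: d;
  rewrite /= !inE !xpair_eqE /= ?andbT ?andbF ?orbF // orbC.
Qed.

(** Every edge of the snake is one of three kinds: the crossing edges, through
    which the chain of tiles enters and leaves (crossing edge [k] separates
    tiles [k - 1] and [k]; numbers [0] and [num_tiles a] are the two edges to be
    glued), and for each tile the boundary edge among its south and west sides
    and the boundary edge among its north and east sides. *)
Definition lower_edge (a : seq nat) (k : nat) : grid_edge :=
  (tile a k, dir a k).
Definition crossing_edge (a : seq nat) (k : nat) : grid_edge :=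
  (tile a k, ~~ dir a k).
Definition upper_edge (a : seq nat) (k : nat) : grid_edge :=
  (step (~~ dir a k.+1) (tile a k), dir a k.+1).

Lemma snake_edgeP (a : seq nat) (e : grid_edge) :
  reflect (exists2 k, k < num_tiles a & e \in sides (tile a k))
          (e \in snake_grid_edges a).
Proof.
apply: (iffP flatten_mapP) => [[p /mapP[k]]|[k ltk ek]].
  by rewrite mem_iota => ltk -> ek; exists k.
by exists (tile a k) => //; apply: map_f; rewrite mem_iota.
Qed.

Lemma snake_pointP (a : seq nat) (v : point) :
  reflect (exists2 k, k < num_tiles a & v \in corners (tile a k))
          (v \in snake_points a).
Proof.
apply: (iffP flatten_mapP) => [[p /mapP[k]]|[k ltk ek]].
  by rewrite mem_iota => ltk -> ek; exists k.
by exists (tile a k) => //; apply: map_f; rewrite mem_iota.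
Qed.

Lemma step_tile_eq (a : seq nat) (d d' : direction) (k j : nat) :
  (step d (tile a k) == step d' (tile a j)) = (k == j) && (d == d').
Proof.
have [<-|neq_kj] := eqVneq k j; first exact: eq_step.
apply/negP => /eqP /(congr1 level); rewrite !level_step !level_tile.
by move=> [] eq_kj; rewrite eq_kj eqxx in neq_kj.
Qed.

Lemma tile_eq_step (a : seq nat) (d : direction) (k j : nat) :
  (tile a k == step d (tile a j)) = (k == j.+1) && (d == dir a k).
Proof.
case: k => [|k]; first by apply/negP => /eqP/(congr1 level); rewrite level_step.
by rewrite tileS step_tile_eq eqSS [d == _]eq_sym.
Qed.

Lemma step_eq_tile (a : seq nat) (d : direction) (k j : nat) :
  (step d (tile a j) == tile a k) = (k == j.+1) && (d == dir a k).
Proof. by rewrite eq_sym tile_eq_step. Qed.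

Lemma eq_tile (a : seq nat) (k j : nat) : (tile a k == tile a j) = (k == j).
Proof. exact: (inj_eq (@tile_inj a)). Qed.

Lemma eq_dirN (d : direction) : (~~ d == d) = false.
Proof. by case: d. Qed.

Lemma eq_dirNr (d : direction) : (d == ~~ d) = false.
Proof. by case: d. Qed.

Lemma neq_dir (d d' : direction) : d <> d' -> d = ~~ d'.
Proof. by case: d; case: d'. Qed.

Lemma eq_step2 (d d1 d2 : direction) (p : point) :
  (step d1 (step d2 p) == step d (step (~~ d) p)) = (d1 == ~~ d2).
Proof.
by case: p => x y; case: d; case: d1; case: d2;
  rewrite /step /= xpair_eqE ?eqxx //; apply/negbTE; lia.
Qed.

(** * Perfect matchings of the snake graph *)

Lemma has_edge_val (a : seq nat) (P : {set edge (snake_graph a)})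
    (f : edge (snake_graph a)) : has_edge P (val f) = (f \in P).
Proof.
apply/exists_inP/idP => [[g Pg /eqP/val_inj <-] //|Pf].
by exists f.
Qed.

Lemma has_edge_snake (a : seq nat) (P : {set edge (snake_graph a)})
    (e : grid_edge) : has_edge P e -> e \in snake_grid_edges a.
Proof. by case/exists_inP=> f _ /eqP <-; apply: valP. Qed.

(** Degrees are computed on explicit lists, which may contain grid edges that
    are not in the snake: these do not count. *)
Lemma card_incident (a : seq nat) (P : {set edge (snake_graph a)})
    (v : vertex (snake_graph a)) (L : seq grid_edge) :
    uniq L -> {in L, forall e, val v \in endpoints e} ->
    {in snake_grid_edges a, forall e, val v \in endpoints e -> e \in L} ->
  #|[set e in P | ends e v]| = \sum_(e <- L) has_edge P e.
Proof.
move=> uniqL endL memL; rewrite cardE -(size_map val).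
have -> : \sum_(e <- L) has_edge P e = size [seq e <- L | has_edge P e].
  rewrite size_filter -sum1_count [RHS]big_mkcond.
  by apply: eq_bigr => e _; case: ifP.
apply/perm_size/uniq_perm; last 1 first.
- move=> e; rewrite mem_filter; apply/mapP/andP => [[f]|[Pe Le]].
    rewrite mem_enum inE => /andP[Pf fv] ->; rewrite has_edge_val Pf.
    by split=> //; apply: memL (valP f) fv.
  have Se := has_edge_snake Pe; exists (SeqSub Se) => //.
  by rewrite mem_enum inE -has_edge_val Pe; apply: endL.
- by rewrite map_inj_uniq ?enum_uniq //; apply: val_inj.
- exact: filter_uniq.
Qed.

Lemma snake_edge_cases (a : seq nat) (e : grid_edge) :
  e \in snake_grid_edges a -> exists2 k, k < num_tiles a &
    e = (tile a k, e.2) \/ e = (step (~~ e.2) (tile a k), e.2).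
Proof.
case/snake_edgeP=> k ltk; rewrite mem_sides => /orP[] /eqP De; exists k => //.
  by left; rewrite -De; case: e {De}.
by right; rewrite -De; case: e {De}.
Qed.

Definition upper_below (a : seq nat) (k : nat) : seq grid_edge :=
  if k is j.+1 then [:: upper_edge a j] else [::].

(** The edges that can end at the corner [step d (tile a k)]; every vertex
    other than the first and the last one is such a corner. *)
Definition edges_at (a : seq nat) (k : nat) (d : direction) : seq grid_edge :=
  (tile a k, d) :: (if d == dir a k then [::] else upper_below a k) ++
  (if d == dir a k.+1 then [:: lower_edge a k.+1; crossing_edge a k.+1]
   else [:: upper_edge a k]).

Lemma edges_at_uniq (a : seq nat) (k : nat) (d : direction) :
  uniq (edges_at a k d).
Proof.
rewrite /edges_at /lower_edge /crossing_edge /upper_edge.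
case: k => [|k]; case: eqP => D1; case: eqP => D2 /=.
all: rewrite ?inE ?xpair_eqE ?tile_eq_step ?step_eq_tile ?step_tile_eq.
all: rewrite ?eq_tile ?eqSS ?(ltn_eqF (ltnSn _)) ?(gtn_eqF (ltnSn _)).
all: by rewrite ?eq_dirN ?eq_dirNr ?andbF.
Qed.

Lemma edges_at_end (a : seq nat) (k : nat) (d : direction) :
  {in edges_at a k d, forall e, step d (tile a k) \in endpoints e}.
Proof.
apply/allP; rewrite /edges_at /lower_edge /crossing_edge /upper_edge /endpoints.
case: k => [|k]; case: eqP => [D1|/neq_dir D1];
  case: eqP => [D2|/neq_dir D2] /=.
all: rewrite ?inE ?[tile a _.+1]tileS -?D1 -?D2 ?(stepC (dir a k.+1) d).
all: by rewrite ?eqxx ?orbT.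
Qed.

Lemma edges_at_mem (a : seq nat) (k : nat) (d : direction) :
  {in snake_grid_edges a, forall e, step d (tile a k) \in endpoints e ->
   e \in edges_at a k d}.
Proof.
move=> e /snake_edge_cases[j _ [] ->];
  rewrite /endpoints mem_seq2 /edges_at in_cons mem_cat /=.
  case/orP; last first.
    by rewrite step_tile_eq => /andP[/eqP <- /eqP <-]; rewrite eqxx.
  rewrite step_eq_tile => /andP[/eqP -> /eqP ->]; rewrite eqxx mem_seq2.
  rewrite /lower_edge /crossing_edge !xpair_eqE eqxx.
  by case: (e.2) (dir _ _) => [] []; rewrite ?orbT.
case/orP.
  rewrite step_tile_eq => /andP[/eqP <- /eqP ->].
  have [D|/eqP/neq_dir D] := eqVneq (~~ e.2) (dir a k.+1).
    by rewrite mem_seq2 /crossing_edge tileS -D negbK eqxx !orbT.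
  by rewrite mem_seq1 /upper_edge (negb_inj D) eqxx !orbT.
move=> end_e.
have Dk : k = j.+1.
  by move/eqP/(congr1 level): end_e; rewrite /= !level_step !level_tile => -[].
move: end_e; rewrite Dk tileS /= eq_step2 => /eqP ->.
rewrite eq_dirN mem_seq1 /upper_edge.
have [->|/eqP/neq_dir ->] := eqVneq e.2 (dir a j.+1).
  by rewrite eqxx orbT.
by rewrite negbK eqxx.
Qed.

Lemma card_incident_step (a : seq nat) (P : {set edge (snake_graph a)})
    (v : vertex (snake_graph a)) (k : nat) (d : direction) :
  val v = step d (tile a k) ->
  #|[set e in P | ends e v]| = \sum_(e <- edges_at a k d) has_edge P e.
Proof.
move=> Dv; apply: card_incident; rewrite ?Dv.
- exact: edges_at_uniq.
- exact: edges_at_end.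
- exact: edges_at_mem.
Qed.

Lemma card_incident_first (a : seq nat) (P : {set edge (snake_graph a)})
    (v : vertex (snake_graph a)) :
  val v = tile a 0 ->
  #|[set e in P | ends e v]| =
    has_edge P (lower_edge a 0) + has_edge P (crossing_edge a 0).
Proof.
move=> Dv; pose L := [:: lower_edge a 0; crossing_edge a 0].
rewrite (@card_incident _ _ _ L) ?Dv /L.
- by rewrite unlock /= addn0.
- rewrite cons_uniq mem_seq1 /lower_edge /crossing_edge xpair_eqE.
  by rewrite eq_dirNr andbF.
- by apply/allP; rewrite /endpoints /= ?inE ?eqxx.
move=> e /snake_edge_cases[j _ [] ->]; rewrite /endpoints mem_seq2 /=.
  rewrite tile_eq_step orbF eq_tile => /eqP <-.
  by rewrite mem_seq2 !xpair_eqE eqxx; case: (e.2) (dir a 0) => [] [].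
by case/orP=> /eqP/(congr1 level); rewrite !level_step !level_tile.
Qed.

Lemma card_incident_last (a : seq nat) (P : {set edge (snake_graph a)})
    (v : vertex (snake_graph a)) (k : nat) :
  num_tiles a = k.+1 -> val v = step (~~ dir a k.+1) (tile a k.+1) ->
  #|[set e in P | ends e v]| =
    has_edge P (upper_edge a k) + has_edge P (crossing_edge a k.+1).
Proof.
move=> DN Dv; pose L := [:: upper_edge a k; crossing_edge a k.+1].
rewrite (@card_incident _ _ _ L) ?Dv /L.
- by rewrite unlock /= addn0.
- rewrite cons_uniq mem_seq1 /upper_edge /crossing_edge xpair_eqE.
  by rewrite step_eq_tile eq_dirN andbF.
- by apply/allP; rewrite /endpoints /= ?inE tileS (stepC (~~ _)) ?eqxx ?orbT.
move=> e /snake_edge_cases[j ltj [] ->]; rewrite /endpoints mem_seq2 /=.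
  rewrite step_eq_tile step_tile_eq => /orP[] /andP[/eqP Dj _]; lia.
case/orP=> [/eqP/(congr1 level)|end_e].
  by rewrite !level_step !level_tile; lia.
have Dj : j = k.
  by move/eqP/(congr1 level): end_e; rewrite !level_step !level_tile => -[].
rewrite Dj mem_seq2 /upper_edge /crossing_edge tileS !xpair_eqE !eq_step.
by case: (e.2) (dir a k.+1) => [] [].
Qed.

Lemma lower_edge_last (a : seq nat) :
  lower_edge a (num_tiles a) \notin snake_grid_edges a.
Proof.
apply/negP => /snake_edge_cases[k ltk] /= [] [] /eqP.
  by rewrite eq_tile => /eqP Dk; rewrite Dk ltnn in ltk.
by rewrite tile_eq_step eq_dirN andbF.
Qed.

Definition upper_below_sum (a : seq nat) (P : {set edge (snake_graph a)}) k :=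
  \sum_(e <- upper_below a k) has_edge P e.

Lemma edges_at_sum (a : seq nat) (P : {set edge (snake_graph a)}) k d :
  \sum_(e <- edges_at a k d) has_edge P e =
  (if d == dir a k then nat_of_bool (has_edge P (lower_edge a k))
   else has_edge P (crossing_edge a k) + upper_below_sum P k) +
  (if d == dir a k.+1 then
    has_edge P (lower_edge a k.+1) + has_edge P (crossing_edge a k.+1)
   else has_edge P (upper_edge a k)).
Proof.
rewrite /edges_at big_cons big_cat /=.
have sum1 e : \sum_(i <- [:: e]) has_edge P i = has_edge P e.
  by rewrite big_seq1.
have sum2 e f :
    \sum_(i <- [:: e; f]) has_edge P i = has_edge P e + has_edge P f.
  by rewrite big_cons sum1.
rewrite -/(upper_below_sum P k); case: eqP => [->|/neq_dir ->]; case: eqP => _.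
all: by rewrite ?big_nil ?sum1 ?sum2 /upper_below_sum !addnA ?addn0.
Qed.

Lemma snake_vertex_cases (a : seq nat) (v : point) (k : nat) :
  num_tiles a = k.+1 -> v \in snake_points a ->
  [\/ v = tile a 0, exists j d, j < num_tiles a /\ v = step d (tile a j) |
   v = step (~~ dir a k.+1) (tile a k.+1)].
Proof.
move=> DN /snake_pointP[j ltj].
have step_case d : [\/ step d (tile a j) = tile a 0,
    exists i d', i < num_tiles a /\ step d (tile a j) = step d' (tile a i) |
   step d (tile a j) = step (~~ dir a k.+1) (tile a k.+1)].
  by constructor 2; exists j, d.
rewrite /corners !inE /= => /or4P[] /eqP->; try exact: step_case.
  case: j {step_case} ltj => [|j] ltj; first by constructor 1.
  constructor 2; exists j, (dir a j.+1); rewrite tileS.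
  by split=> //; apply: ltnW.
have -> : step North (step East (tile a j)) =
    step (~~ dir a j.+1) (step (dir a j.+1) (tile a j)).
  by case: (dir a j.+1) => //; rewrite stepC.
rewrite -tileS; move: (ltj); rewrite DN ltnS leq_eqVlt => /predU1P[->|lt_jk].
  by constructor 3.
by constructor 2; exists j.+1, (~~ dir a j.+1).
Qed.

Lemma step_tile_point (a : seq nat) (k : nat) (d : direction) :
  k < num_tiles a -> step d (tile a k) \in snake_points a.
Proof.
move=> ltk; apply/snake_pointP; exists k => //.
by case: d; rewrite /corners !inE eqxx ?orbT.
Qed.

Lemma tile_point (a : seq nat) (k : nat) :
  k < num_tiles a -> tile a k \in snake_points a.
Proof. by move=> ltk; apply/snake_pointP; exists k; rewrite ?inE ?eqxx. Qed.

(** The edges of the snake between two consecutive antidiagonals are a lower, a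
    crossing and an upper edge (the lower one is missing at the end of the
    snake, the upper one at its beginning).  A perfect matching contains exactly
    one of them: this holds on the first antidiagonal, which has one vertex, and
    then propagates, as each inner antidiagonal has two vertices, one of which
    is matched from before and the other one onwards.  The upper edge of tile
    [k] is the only way onwards from its first vertex; the lower edge of the
    tile ends at that vertex if the chain turns at the tile, and at the other
    vertex of the antidiagonal if it goes straight.  This is the second
    equation. *)
Lemma snake_matchingP (a : seq nat) (P : {set edge (snake_graph a)}) :
  0 < num_tiles a ->
  perfect_matching P <->
  (forall k, k <= num_tiles a ->
     has_edge P (lower_edge a k) + has_edge P (crossing_edge a k) +
     upper_below_sum P k = 1) /\
  (forall k, k < num_tiles a ->
     has_edge P (upper_edge a k) =
     has_edge P (lower_edge a k) (+) (dir a k != dir a k.+1)).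
Proof.
move=> N_gt0.
have W0 : upper_below_sum P 0 = 0 by rewrite /upper_below_sum big_nil.
have WS k : upper_below_sum P k.+1 = has_edge P (upper_edge a k).
  by rewrite /upper_below_sum big_seq1.
split=> [/forallP matchP|[levelP upperP]].
  have deg v (pv : v \in snake_points a) := eqP (matchP (SeqSub pv)).
  have level0 : has_edge P (lower_edge a 0) + has_edge P (crossing_edge a 0) +
      upper_below_sum P 0 = 1.
    rewrite W0 addn0 -(deg _ (tile_point N_gt0)).
    by rewrite (@card_incident_first a P (SeqSub (tile_point N_gt0)) erefl).
  have levelS k : k < num_tiles a ->
      has_edge P (lower_edge a k) + has_edge P (crossing_edge a k) +
      upper_below_sum P k = 1 ->
      has_edge P (upper_edge a k) =
        has_edge P (lower_edge a k) (+) (dir a k != dir a k.+1) /\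
      has_edge P (lower_edge a k.+1) + has_edge P (crossing_edge a k.+1) +
      upper_below_sum P k.+1 = 1.
    move=> ltk; rewrite WS.
    have := deg _ (step_tile_point (dir a k) ltk).
    have := deg _ (step_tile_point (~~ dir a k) ltk).
    have degE d := @card_incident_step a P
      (SeqSub (step_tile_point d ltk)) k d erefl.
    rewrite !degE {degE}.
    rewrite !edges_at_sum eqxx eq_dirN.
    have [->|/eqP/neq_dir ->] := eqVneq (dir a k) (dir a k.+1).
      rewrite ?eqxx ?eq_dirN; move: (upper_below_sum P k).
      by do 5![case: has_edge] => ? //=; lia.
    rewrite ?negbK ?eqxx ?eq_dirN; move: (upper_below_sum P k).
    by do 5![case: has_edge] => ? //=; lia.
  have levelP k : k <= num_tiles a -> has_edge P (lower_edge a k) +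
      has_edge P (crossing_edge a k) + upper_below_sum P k = 1.
    elim: k => // k IHk ltk; have /IHk := ltnW ltk.
    by case/(levelS k ltk).
  by split=> // k ltk; case: (levelS k ltk (levelP k (ltnW ltk))).
apply/forallP=> v; apply/eqP.
case DN: (num_tiles a) N_gt0 => [//|N] _.
case: (snake_vertex_cases DN (valP v)) => [Dv|[k [d [ltk Dv]]]|Dv].
- by rewrite (card_incident_first _ Dv) -(levelP 0) // W0 addn0.
- rewrite (card_incident_step _ Dv) edges_at_sum.
  have := levelP _ (ltnW ltk); have := levelP _ ltk; have := upperP _ ltk.
  rewrite WS; move: (upper_below_sum P k).
  by case: d (dir a k) (dir a k.+1) {Dv} => [] [] [] /=;
    do 5![case: has_edge] => ? //=; lia.
have lower_last : has_edge P (lower_edge a (num_tiles a)) = false.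
  exact: contraNF (@has_edge_snake _ P _) (lower_edge_last a).
have := levelP _ (leqnn _); rewrite lower_last DN.
by rewrite (card_incident_last _ DN Dv) WS => <-; rewrite addnC.
Qed.

(** * Heights of perfect matchings *)

(** In how many of [m] matchings the sides of tile [k] in direction [d] are
    excluded by the state of the tile, when [h k] of the matchings have the
    tile flipped up: by [mem_black_to_white], the test selects the sides that
    an up-flip adds. *)
Definition side_weight (m : nat) (h : nat -> nat) (k : nat) (d : direction) :
    nat :=
  if d (+) odd k then m - h k else h k.

(** The amount by which the multiplicity of [e] falls short of [m]. *)
Definition snake_drop (a : seq nat) (m : nat) (h : nat -> nat) (e : grid_edge) :
    nat :=
  \sum_(k < num_tiles a | e \in sides (tile a k)) side_weight m h k e.2.

Lemma lower_edge_sides (a : seq nat) (k j : nat) :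
  (lower_edge a k \in sides (tile a j)) = (j == k).
Proof.
by rewrite mem_sides eq_tile tile_eq_step eq_dirN andbF orbF eq_sym.
Qed.

Lemma upper_edge_sides (a : seq nat) (k j : nat) :
  (upper_edge a k \in sides (tile a j)) = (j == k).
Proof.
rewrite mem_sides step_eq_tile step_tile_eq eqxx andbT [k == j]eq_sym.
by case: (j =P k.+1) => // ->; rewrite eq_dirN.
Qed.

Lemma crossing_edge_sides (a : seq nat) (k j : nat) :
  (crossing_edge a k \in sides (tile a j)) = (j == k) || (j.+1 == k).
Proof.
by rewrite mem_sides eq_tile tile_eq_step negbK eqxx andbT !(eq_sym k).
Qed.

Lemma snake_drop_lower (a : seq nat) (m : nat) (h : nat -> nat) (k : nat) :
  k < num_tiles a ->
  snake_drop a m h (lower_edge a k) = side_weight m h k (dir a k).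
Proof.
move=> ltk; rewrite /snake_drop; under eq_bigl do rewrite lower_edge_sides.
by rewrite (big_ord1_eq _ (fun i => side_weight m h i _)) ltk.
Qed.

Lemma snake_drop_upper (a : seq nat) (m : nat) (h : nat -> nat) (k : nat) :
  k < num_tiles a ->
  snake_drop a m h (upper_edge a k) = side_weight m h k (dir a k.+1).
Proof.
move=> ltk; rewrite /snake_drop; under eq_bigl do rewrite upper_edge_sides.
by rewrite (big_ord1_eq _ (fun i => side_weight m h i _)) ltk.
Qed.

Lemma snake_drop_crossing (a : seq nat) (m : nat) (h : nat -> nat) (k : nat) :
  snake_drop a m h (crossing_edge a k) =
    (if k < num_tiles a then side_weight m h k (~~ dir a k) else 0) +
    (if k is j.+1 then
       if j < num_tiles a then side_weight m h j (~~ dir a k) else 0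
     else 0).
Proof.
rewrite /snake_drop; under eq_bigl do rewrite crossing_edge_sides.
rewrite (bigID (fun j : 'I__ => val j == k)) /=; congr (_ + _).
  rewrite (eq_bigl (fun j : 'I__ => val j == k)); last first.
    by move=> j /=; case: (nat_of_ord j == k); rewrite ?andbF.
  by rewrite (big_ord1_eq _ (fun i => side_weight m h i _)).
case: k => [|k]; first by rewrite big_pred0 // => j; rewrite orbF andbN.
rewrite (eq_bigl (fun j : 'I__ => val j == k)).
  by rewrite (big_ord1_eq _ (fun i => side_weight m h i _)).
move=> j; rewrite /= eqSS; have [->|_] := eqVneq (j : nat) k.
  by rewrite orbT (ltn_eqF (ltnSn _)).
by rewrite orbF andbN.
Qed.

Lemma entry_crossing (a : seq nat) : entry_edge = crossing_edge a 0.
Proof. by []. Qed.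

Lemma exit_crossing (a : seq nat) :
  0 < num_tiles a -> exit_edge a = crossing_edge a (num_tiles a).
Proof.
rewrite /exit_edge; case: num_tiles => // k _.
by rewrite /crossing_edge tileS /=; case: (dir a k.+1).
Qed.

Variant snake_edge_spec (a : seq nat) : grid_edge -> Prop :=
  | SnakeLower k of k < num_tiles a : snake_edge_spec a (lower_edge a k)
  | SnakeUpper k of k < num_tiles a : snake_edge_spec a (upper_edge a k)
  | SnakeCrossing k of k <= num_tiles a : snake_edge_spec a (crossing_edge a k).

Lemma snake_edge_specP (a : seq nat) (e : grid_edge) :
  e \in snake_grid_edges a -> snake_edge_spec a e.
Proof.
case/snake_edge_cases=> k ltk [] ->.
  have [->|/eqP/neq_dir ->] := eqVneq e.2 (dir a k); first exact: SnakeLower.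
  exact/SnakeCrossing/ltnW.
have [->|/eqP/neq_dir ->] := eqVneq e.2 (dir a k.+1); first exact: SnakeUpper.
by rewrite negbK -tileS; apply: SnakeCrossing.
Qed.

Lemma lower_edge_in (a : seq nat) (k : nat) :
  k < num_tiles a -> lower_edge a k \in snake_grid_edges a.
Proof.
by move=> ltk; apply/snake_edgeP; exists k; rewrite ?lower_edge_sides.
Qed.

Lemma upper_edge_in (a : seq nat) (k : nat) :
  k < num_tiles a -> upper_edge a k \in snake_grid_edges a.
Proof.
by move=> ltk; apply/snake_edgeP; exists k; rewrite ?upper_edge_sides.
Qed.

Lemma crossing_edge_in (a : seq nat) (k : nat) :
  0 < num_tiles a -> k <= num_tiles a ->
  crossing_edge a k \in snake_grid_edges a.
Proof.
case: k => [|k] N_gt0 ltk; apply/snake_edgeP.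
  by exists 0; rewrite ?crossing_edge_sides.
by exists k; rewrite ?crossing_edge_sides ?eqxx ?orbT.
Qed.

(** The height of a tile is read off its lower edge, which lies on no other
    tile.  The two conditions of [snake_matchingP] then say that the upper edge
    of the tile agrees with that height, and that the crossing edges are present
    exactly when neither of the tiles at their sides excludes them. *)
Lemma snake_matching_heights (a : seq nat) (P : {set edge (snake_graph a)}) :
  0 < num_tiles a ->
  perfect_matching P <->
  exists2 h : nat -> nat, forall k, h k <= 1 &
    forall e, e \in snake_grid_edges a ->
      has_edge P e + snake_drop a 1 h e = 1.
Proof.
move=> N_gt0; rewrite (snake_matchingP _ N_gt0).
have lower_last : has_edge P (lower_edge a (num_tiles a)) = false.
  exact: contraNF (@has_edge_snake _ P _) (lower_edge_last a).
have W0 : upper_below_sum P 0 = 0 by rewrite /upper_below_sum big_nil.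
have WS k : upper_below_sum P k.+1 = has_edge P (upper_edge a k).
  by rewrite /upper_below_sum big_seq1.
split=> [[levelP upperP]|[h h_le1 hP]].
  (* The lower edge is in [P] when its kind fits the state of the tile. *)
  pose h k : nat := has_edge P (lower_edge a k) (+) ~~ (dir a k (+) odd k).
  exists h => [k|e /snake_edge_specP[k ltk|k ltk|k lek]]; first exact: leq_b1.
  - rewrite snake_drop_lower // /side_weight /h.
    by case: has_edge; case: (dir a k); case: odd.
  - rewrite snake_drop_upper // (upperP _ ltk) /side_weight /h.
    by case: (dir a k.+1); case: (dir a k); case: has_edge; case: odd.
  have := levelP _ lek; rewrite snake_drop_crossing.
  case: k lek => [|k] lek.
    rewrite N_gt0 W0 /side_weight /h /=.
    by do 2![case: has_edge] => //; case: (dir a 0).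
  rewrite WS (upperP _ lek) lek /side_weight /h /=.
  move: lek; rewrite leq_eqVlt => /predU1P[DN|->].
    rewrite DN ltnn lower_last.
    by do 2![case: has_edge] => //;
      case: (dir a k); case: (dir a _); case: (odd k).
  by do 3![case: has_edge] => //;
    case: (dir a k); case: (dir a _); case: (odd k).
have lowerE k (ltk : k < num_tiles a) := hP _ (lower_edge_in ltk).
have upperE k (ltk : k < num_tiles a) := hP _ (upper_edge_in ltk).
have crossE k (lek : k <= num_tiles a) := hP _ (crossing_edge_in N_gt0 lek).
split=> [k lek|k ltk]; last first.
  have := upperE _ ltk; have := lowerE _ ltk.
  rewrite snake_drop_lower ?snake_drop_upper // /side_weight.
  have := h_le1 k; case: (h k) => [|[|//]] _;
  by do 2![case: has_edge]; case: (dir a k); case: (dir a _); case: (odd k).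
have := crossE _ lek; rewrite snake_drop_crossing.
case: k lek => [|k] lek.
  have := lowerE _ N_gt0; rewrite snake_drop_lower // N_gt0 W0 /side_weight.
  have := h_le1 0; case: (h 0) => [|[|//]] _;
  by do 2![case: has_edge]; case: (dir a 0).
have := upperE _ lek; rewrite snake_drop_upper // WS lek /side_weight.
move: lek; rewrite leq_eqVlt => /predU1P[DN|ltk].
  rewrite -DN in lower_last; rewrite DN ltnn -DN lower_last.
  have := h_le1 k; case: (h k) => [|[|//]] _;
  by do 2![case: has_edge] => //; case: (dir a _); case: (odd k).
rewrite ltk; have := lowerE _ ltk; rewrite snake_drop_lower // /side_weight /=.
have := h_le1 k; case: (h k) => [|[|//]] _;
have := h_le1 k.+1; case: (h k.+1) => [|[|//]] _;
by do 3![case: has_edge] => //; case: (dir a _); case: (odd k).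
Qed.

(** * Gluing *)

Lemma entry_neq_exit (a : seq nat) :
  0 < num_tiles a -> (entry_edge == exit_edge a) = false.
Proof.
move=> N_gt0; rewrite exit_crossing // (entry_crossing a) xpair_eqE eq_tile.
by rewrite eq_sym eqn0Ngt N_gt0.
Qed.

Lemma mem_glue (a : seq nat) (s : seq grid_edge) (e : grid_edge) :
  0 < num_tiles a ->
  (e \in [seq glue_edge a f | f <- s]) =
    (e != exit_edge a) && (e \in s) || (e == entry_edge) && (exit_edge a \in s).
Proof.
move=> N_gt0; have neq := entry_neq_exit N_gt0.
apply/mapP/orP => [[f sf ->]|[/andP[neq_e se]|/andP[/eqP -> se]]].
- rewrite /glue_edge; have [<-|neq_f] := eqVneq f (exit_edge a).
    by right; rewrite eqxx.
  by left; rewrite neq_f.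
- by exists e; rewrite // /glue_edge (negbTE neq_e).
by exists (exit_edge a); rewrite // /glue_edge eqxx.
Qed.

Lemma entry_sides (a : seq nat) (k : nat) :
  (entry_edge \in sides (tile a k)) = (k == 0).
Proof. by rewrite (entry_crossing a) crossing_edge_sides orbF. Qed.

Lemma exit_sides (a : seq nat) (k : nat) : k < num_tiles a ->
  (exit_edge a \in sides (tile a k)) = (k.+1 == num_tiles a).
Proof.
move=> ltk; rewrite exit_crossing ?(leq_trans _ ltk) // crossing_edge_sides.
by rewrite (ltn_eqF ltk).
Qed.

Definition up_side (a : seq nat) (k : nat) (e : grid_edge) : bool :=
  e \in [seq glue_edge a f | f <- black_to_white (tile a k)].
Definition down_side (a : seq nat) (k : nat) (e : grid_edge) : bool :=
  e \in [seq glue_edge a f | f <- white_to_black (tile a k)].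

(** The analogue of [snake_drop], in terms of the lists of sides that up-flips
    use, so that the effect of raising one tile is immediate. *)
Definition band_drop (a : seq nat) (m : nat) (h : nat -> nat) (e : grid_edge) :
    nat :=
  \sum_(k < num_tiles a) (up_side a k e * (m - h k) + down_side a k e * h k).

Lemma snake_drop_sum (a : seq nat) (m : nat) (h : nat -> nat) (e : grid_edge) :
  snake_drop a m h e =
  \sum_(k < num_tiles a) ((e \in black_to_white (tile a k)) * (m - h k) +
                          (e \in white_to_black (tile a k)) * h k).
Proof.
rewrite /snake_drop big_mkcond; apply: eq_bigr => k _.
rewrite mem_black_to_white mem_white_to_black level_tile /side_weight.
by case: (e \in _); case: (_ (+) _); rewrite /= ?mul0n ?mul1n ?addn0.
Qed.

(** The glued edge is a side of the first and of the last tile.  These are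
    distinct, so that its two copies are not sides of one tile. *)
Lemma band_dropE (a : seq nat) (m : nat) (h : nat -> nat) (e : grid_edge) :
  1 < num_tiles a -> e != exit_edge a ->
  band_drop a m h e =
    snake_drop a m h e +
    (if e == entry_edge then snake_drop a m h (exit_edge a) else 0).
Proof.
move=> N_gt1 neq_e; have N_gt0 := ltnW N_gt1.
rewrite /band_drop !snake_drop_sum.
have [De|neq_entry] := eqVneq e entry_edge.
  rewrite -big_split; apply: eq_bigr => k _ /=.
  rewrite /up_side /down_side !mem_glue // neq_e De eqxx /=.
  rewrite !mem_black_to_white !mem_white_to_black !entry_sides !exit_sides //.
  have [k0|k_neq0] := eqVneq (k : nat) 0; last by rewrite !mul0n add0n.
  have -> : (k.+1 == num_tiles a) = false by rewrite k0 (ltn_eqF N_gt1).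
  by rewrite !mul0n !addn0 !orbF.
rewrite addn0; apply: eq_bigr => k _.
by rewrite /up_side /down_side !mem_glue // neq_e (negbTE neq_entry) !orbF.
Qed.

Lemma band_edgeP (a : seq nat) (e : grid_edge) : 0 < num_tiles a ->
  (e \in [seq glue_edge a f | f <- snake_grid_edges a]) =
  (e \in snake_grid_edges a) && (e != exit_edge a).
Proof.
move=> N_gt0; rewrite mem_glue //.
have [->|_] := eqVneq e entry_edge; last by rewrite orbF andbC.
rewrite (entry_neq_exit N_gt0) (entry_crossing a) exit_crossing //.
by rewrite !crossing_edge_in.
Qed.

Lemma band_edge_of (a : seq nat) (e : grid_edge) :
  0 < num_tiles a -> e \in snake_grid_edges a -> e != exit_edge a ->
  exists f : edge (band_graph a), val f = e.
Proof.
move=> N_gt0 Se neq_e.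
have be : e \in [seq glue_edge a f | f <- snake_grid_edges a].
  by rewrite band_edgeP // Se.
by exists (SeqSub be).
Qed.

Lemma entry_in (a : seq nat) :
  0 < num_tiles a -> entry_edge \in snake_grid_edges a.
Proof. by move=> N_gt0; rewrite (entry_crossing a) crossing_edge_in. Qed.

Lemma exit_in (a : seq nat) :
  0 < num_tiles a -> exit_edge a \in snake_grid_edges a.
Proof. by move=> N_gt0; rewrite exit_crossing // crossing_edge_in. Qed.

(** In the case where the matching contains only one of the two copies of the
    glued edge, that copy is removed, so the glued edge survives only if both
    are present. *)
Lemma mem_matching_image (a : seq nat) (P : {set edge (snake_graph a)})
    (e : edge (band_graph a)) : 0 < num_tiles a ->
  (e \in matching_image P) =
    if val e == entry_edge then
      has_edge P entry_edge && has_edge P (exit_edge a)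
    else has_edge P (val e).
Proof.
move=> N_gt0; have := valP e; rewrite band_edgeP // => /andP[Se neq_exit].
have neq := entry_neq_exit N_gt0.
have image (Q : {set edge (snake_graph a)}) :
    reflect (exists2 f, f \in Q & val e = glue_edge a (val f))
            (e \in @glue a @: Q).
  apply: (iffP imsetP) => -[f Qf Df]; exists f => //; first by rewrite Df.
  exact: val_inj.
rewrite /matching_image; have [De|neq_entry] := eqVneq (val e) entry_edge.
  case: ifP => [/andP[Pentry _]|_].
    apply/image; case/exists_inP: Pentry => f Pf /eqP Df; exists f => //.
    by rewrite De Df /glue_edge neq.
  apply/image => -[f]; rewrite !inE negb_or De => /and3P[_ f_entry f_exit].
  by rewrite /glue_edge (negbTE f_exit) => Df; rewrite -Df eqxx in f_entry.
have val_f f : val e = glue_edge a (val f) -> val f = val e.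
  rewrite /glue_edge; case: eqP => // _ De.
  by rewrite De eqxx in neq_entry.
have -> : has_edge P (val e) = (SeqSub Se \in P) by rewrite -has_edge_val.
have glueE : val e = glue_edge a (val (SeqSub Se)).
  by rewrite /glue_edge /= (negbTE neq_exit).
case: ifP => _; apply/image/idP => [[f]|Pe].
- by move=> Pf /val_f Df; rewrite (_ : SeqSub Se = f) //; apply: val_inj.
- by exists (SeqSub Se).
- rewrite inE => /andP[Pf _] /val_f Df.
  by rewrite (_ : SeqSub Se = f) //; apply: val_inj.
exists (SeqSub Se) => //.
by rewrite !inE Pe /= negb_or neq_entry.
Qed.

Lemma snake_matching_unique (a : seq nat) (P : {set edge (snake_graph a)})
    (u : point) :
  perfect_matching P -> u \in snake_points a ->
  exists e, [/\ has_edge P e, u \in endpoints e &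
    forall f, has_edge P f -> u \in endpoints f -> f = e].
Proof.
move=> /forallP/(_ (SeqSub _)) matchP pu; have /cards1P[e De] := matchP _ pu.
have memP f : (f \in P) && (u \in endpoints (val f)) = (f == e).
  by have /setP/(_ f) := De; rewrite inE in_set1.
have /andP[Pe ue] : (e \in P) && (u \in endpoints (val e)) by rewrite memP eqxx.
exists (val e); rewrite has_edge_val; split=> // f Pf uf.
have Sf := has_edge_snake Pf; rewrite -[f]/(val (SeqSub Sf)) in Pf uf *.
by rewrite has_edge_val in Pf; congr val; apply/eqP; rewrite -memP Pf.
Qed.

Lemma level_endpoints (e : grid_edge) (u : point) :
  u \in endpoints e -> level e.1 <= level u <= (level e.1).+1.
Proof.
by rewrite mem_seq2 => /orP[] /eqP ->; rewrite ?level_step ?leqnn ?leqnSn.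
Qed.

Lemma mem_endpoints (e : grid_edge) (u : point) :
  (u \in endpoints e) = (u == black_end e) || (u == white_end e).
Proof.
by rewrite mem_seq2 /black_end /white_end; case: ifP => _ //; rewrite orbC.
Qed.

Lemma black_neq_white (e : grid_edge) : black_end e != white_end e.
Proof.
rewrite /black_end /white_end; case: ifP => _; apply/eqP => /(congr1 level);
  rewrite level_step; lia.
Qed.

Lemma entry_exit_disjoint (a : seq nat) (u : point) : 1 < num_tiles a ->
  u \in endpoints entry_edge -> u \in endpoints (exit_edge a) -> False.
Proof.
move=> N_gt1 /level_endpoints/andP[_ le1].
rewrite (exit_crossing (ltnW N_gt1)) => /level_endpoints/andP[leN _].
have := leq_trans leN le1; rewrite /crossing_edge [_.1]/= level_tile.
by rewrite leqNgt N_gt1.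
Qed.

Lemma glue_point_id (a : seq nat) (u : point) :
  u \notin endpoints (exit_edge a) -> glue_point a u = u.
Proof.
by rewrite mem_endpoints negb_or /glue_point => /andP[/negbTE -> /negbTE ->].
Qed.

Lemma glue_point_exit (a : seq nat) (u : point) :
  u \in endpoints (exit_edge a) -> glue_point a u \in endpoints entry_edge.
Proof.
by rewrite /glue_point !mem_endpoints; do 2?case: ifP; rewrite ?eqxx ?orbT.
Qed.

(** An endpoint of the glued edge comes from itself and from the endpoint of the
    exit edge that has the same color. *)
Lemma glue_point_twin (a : seq nat) (v : point) : v \in endpoints entry_edge ->
  exists2 v', v' \in endpoints (exit_edge a) &
    forall u, glue_point a u = v <->
      u = v' \/ u = v /\ u \notin endpoints (exit_edge a).
Proof.
have bw := black_neq_white (exit_edge a).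
have bw0 := black_neq_white entry_edge.
have glueb : glue_point a (black_end (exit_edge a)) = black_end entry_edge.
  by rewrite /glue_point eqxx.
have gluew : glue_point a (white_end (exit_edge a)) = white_end entry_edge.
  by rewrite /glue_point eq_sym (negbTE bw) eqxx.
rewrite mem_endpoints => /orP[] /eqP ->.
  exists (black_end (exit_edge a)); first by rewrite mem_endpoints eqxx.
  move=> u; split=> [|[->|[-> /glue_point_id]] //].
  have [|nu] := boolP (u \in endpoints (exit_edge a)).
    rewrite mem_endpoints => /orP[] /eqP ->; first by left.
    by rewrite gluew => eq_wb; rewrite eq_wb eqxx in bw0.
  by rewrite (glue_point_id nu) => ->; right.
exists (white_end (exit_edge a)); first by rewrite mem_endpoints eqxx orbT.
move=> u; split=> [|[->|[-> /glue_point_id]] //].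
have [|nu] := boolP (u \in endpoints (exit_edge a)).
  rewrite mem_endpoints => /orP[] /eqP ->; last by left.
  by rewrite glueb => eq_wb; rewrite eq_wb eqxx in bw0.
by rewrite (glue_point_id nu) => ->; right.
Qed.

Lemma edge_endpoints_in (a : seq nat) (e : grid_edge) (u : point) :
  e \in snake_grid_edges a -> u \in endpoints e -> u \in snake_points a.
Proof.
case/snake_edgeP=> k ltk; rewrite mem_sides mem_seq2.
case/orP=> /eqP ->; rewrite -/(step _ _) => /orP[] /eqP ->;
  rewrite ?step_tile_point ?tile_point //.
apply/snake_pointP; exists k => //.
by case: (e.2);
  rewrite /corners !inE ?[step East (step North _)]stepC ?eqxx ?orbT.
Qed.

(** An endpoint [v] of the glued edge has two preimages in the snake.  If the
    matching contains both copies of the glued edge, these match both preimages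
    and become the one edge at [v]; if it contains one copy, that copy is
    removed and [v] is matched by the edge at the other preimage.  Away from the
    glued edge nothing changes. *)
Lemma matching_image_perfect (a : seq nat) (P : {set edge (snake_graph a)}) :
  1 < num_tiles a -> perfect_matching P ->
  has_edge P entry_edge || has_edge P (exit_edge a) ->
  perfect_matching (matching_image P).
Proof.
move=> N_gt1 matchP entry_or_exit; have N_gt0 := ltnW N_gt1.
apply/forallP => v; apply/cards1P.
have [u0 pu0 Dv] := mapP (valP v).
have incident e : (e \in [set e in matching_image P | ends e v]) =
    if val e == entry_edge then
      [&& has_edge P entry_edge, has_edge P (exit_edge a) &
          val v \in endpoints entry_edge]
    else has_edge P (val e) &&
         has (fun u => glue_point a u == val v) (endpoints (val e)).
  rewrite inE mem_matching_image // /=.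
  have -> : (val v \in [seq glue_point a u | u <- endpoints (val e)]) =
            has (fun u => glue_point a u == val v) (endpoints (val e)).
    apply/mapP/hasP => -[u eu]; first by move->; exists u.
    by move/eqP; exists u.
  have [->|//] := eqVneq (val e) entry_edge.
  rewrite -andbA; congr [&& _, _ & _].
  apply/hasP/idP => [[u entry_u /eqP <-]|entry_v].
    by rewrite glue_point_id //; apply/negP; apply: entry_exit_disjoint entry_u.
  exists (val v); rewrite // glue_point_id //.
  by apply/negP; apply: entry_exit_disjoint entry_v.
have edge_of e : has_edge P e -> e != exit_edge a ->
    exists f : edge (band_graph a), val f = e.
  by move=> /has_edge_snake; apply: band_edge_of.
have neq_exit (f : edge (band_graph a)) : val f != exit_edge a.
  by have := valP f; rewrite band_edgeP // => /andP[].
have [entry_v|nentry_v] := boolP (val v \in endpoints entry_edge); last first.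
  have nexit_u0 : u0 \notin endpoints (exit_edge a).
    by apply: contra nentry_v => /glue_point_exit; rewrite -Dv.
  have Du0 : u0 = val v by rewrite Dv glue_point_id.
  have glue_v u : glue_point a u = val v -> u = val v.
    have [/glue_point_exit|/glue_point_id -> //] :=
      boolP (u \in endpoints (exit_edge a)).
    by move=> entry_u Du; rewrite -Du entry_u in nentry_v.
  have [e0 [Pe0 e0_u e0_uniq]] := snake_matching_unique matchP pu0.
  have [f0 Df0] : exists f : edge (band_graph a), val f = e0.
    by apply: edge_of => //; apply: contraNneq nexit_u0 => <-.
  exists f0; apply/setP => f; rewrite incident inE.
  have neq_e0 : e0 != entry_edge.
    by apply: contraNneq nentry_v => <-; rewrite -Du0.
  have [Df|_] := eqVneq (val f) entry_edge.
    rewrite (negbTE nentry_v) !andbF; apply/esym/eqP => eq_f.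
    by rewrite -Df0 -eq_f Df eqxx in neq_e0.
  apply/andP/eqP => [[Pf /hasP[u fu /eqP/glue_v Du]]|->].
    by apply/val_inj; rewrite Df0; apply: e0_uniq => //; rewrite Du0 -Du.
  by rewrite Df0; split=> //; apply/hasP; exists u0; rewrite // Dv.
have [v' exit_v' glue_v] := glue_point_twin a entry_v.
have nexit_v : val v \notin endpoints (exit_edge a).
  by apply/negP; apply: entry_exit_disjoint entry_v.
have nentry_v' : v' \notin endpoints entry_edge.
  by apply/negP => entry_v'; apply: entry_exit_disjoint exit_v'.
have [e1 [Pe1 e1_v e1_uniq]] := snake_matching_unique matchP
  (edge_endpoints_in (entry_in N_gt0) entry_v).
have [e2 [Pe2 e2_v' e2_uniq]] := snake_matching_unique matchP
  (edge_endpoints_in (exit_in N_gt0) exit_v').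
have incident_cases (f : edge (band_graph a)) : val f != entry_edge ->
    (f \in [set e in matching_image P | ends e v]) =
    (val f == e1) || (val f == e2).
  move=> neq_f; rewrite incident (negbTE neq_f).
  apply/andP/orP => [[Pf /hasP[u fu /eqP/glue_v[Du|[Du _]]]]|].
  - by right; apply/eqP/e2_uniq => //; rewrite -Du.
  - by left; apply/eqP/e1_uniq => //; rewrite -Du.
  case=> /eqP ->; split=> //; apply/hasP.
    by exists (val v) => //; apply/eqP/glue_v; right.
  by exists v' => //; apply/eqP/glue_v; left.
have [Pentry|/negbTE Pentry] := boolP (has_edge P entry_edge); last first.
  rewrite Pentry /= in entry_or_exit; move: entry_or_exit => Pexit.
  have De2 : e2 = exit_edge a by rewrite -(e2_uniq _ Pexit).
  have [|f0 Df0] := edge_of _ Pe1; first by apply: contraNneq nexit_v => <-.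
  exists f0; apply/setP => f; rewrite in_set1 -val_eqE Df0.
  have [Df|neq_f] := eqVneq (val f) entry_edge; last first.
    by rewrite incident_cases // De2 (negbTE (neq_exit f)) orbF.
  rewrite incident Df eqxx Pentry; apply/esym.
  by apply: contraFF Pentry => /eqP ->.
have De1 : e1 = entry_edge by rewrite -(e1_uniq _ Pentry).
case Pexit: (has_edge P (exit_edge a)).
  have De2 : e2 = exit_edge a by rewrite -(e2_uniq _ Pexit).
  have [|f0 Df0] := edge_of _ Pentry; first by rewrite entry_neq_exit.
  exists f0; apply/setP => f; rewrite in_set1 -val_eqE Df0.
  have [Df|neq_f] := eqVneq (val f) entry_edge.
    by rewrite incident Df eqxx Pentry Pexit entry_v.
  by rewrite incident_cases // De1 De2 (negbTE neq_f) (negbTE (neq_exit f)).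
have [|f0 Df0] := edge_of _ Pe2; first by apply: contraFneq Pexit => <-.
exists f0; apply/setP => f; rewrite in_set1 -val_eqE Df0.
have [Df|neq_f] := eqVneq (val f) entry_edge; last first.
  by rewrite incident_cases // De1 (negbTE neq_f).
rewrite incident Df eqxx Pexit andbF; apply/esym.
by apply: contraNF nentry_v' => /eqP ->.
Qed.

(** * Good matchings *)

(** The sum of the deficiencies of the two copies of the glued edge is at most
    [1] exactly when one of the copies is in the matching of the snake.  This is
    how goodness turns into a bound on [band_drop] at the glued edge. *)
Lemma good_matchingP (a : seq nat) (Q : {set edge (band_graph a)}) :
  1 < num_tiles a ->
  good_matching Q <->
  exists2 h : nat -> nat, forall k, h k <= 1 &
    forall e : edge (band_graph a), (e \in Q) + band_drop a 1 h (val e) = 1.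
Proof.
move=> N_gt1; have N_gt0 := ltnW N_gt1.
have band_in (e : edge (band_graph a)) :
    val e \in snake_grid_edges a /\ val e != exit_edge a.
  by have := valP e; rewrite band_edgeP // => /andP.
have imageP (P : {set edge (snake_graph a)}) (h : nat -> nat) :
    has_edge P entry_edge || has_edge P (exit_edge a) ->
    (forall e, e \in snake_grid_edges a ->
       has_edge P e + snake_drop a 1 h e = 1) ->
    forall e : edge (band_graph a),
      (e \in matching_image P) + band_drop a 1 h (val e) = 1.
  move=> entry_or_exit hP e; have [Se neq_e] := band_in e.
  rewrite mem_matching_image // band_dropE //.
  have [De|_] := eqVneq (val e) entry_edge; last by rewrite addn0 hP.
  have := hP _ (entry_in N_gt0); have := hP _ (exit_in N_gt0); rewrite De.
  by move: entry_or_exit; do 2![case: has_edge] => //= _; lia.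
split=> [/andP[_]|[h h_le1 hQ]].
  case/existsP=> P /and3P[matchP entry_or_exit /eqP ->].
  have [h h_le1 hP] := proj1 (snake_matching_heights P N_gt0) matchP.
  by exists h => //; apply: imageP.
have band_le1 e : e \in snake_grid_edges a -> e != exit_edge a ->
    band_drop a 1 h e <= 1.
  by move=> Se neq_e; have [f <-] := band_edge_of N_gt0 Se neq_e;
    have := hQ f; lia.
have entry_le1 :
    snake_drop a 1 h entry_edge + snake_drop a 1 h (exit_edge a) <= 1.
  have := band_le1 _ (entry_in N_gt0).
  by rewrite band_dropE ?entry_neq_exit // eqxx; apply.
have drop_le1 e : e \in snake_grid_edges a -> snake_drop a 1 h e <= 1.
  move=> Se; have [->|neq_e] := eqVneq e (exit_edge a).
    exact: leq_trans (leq_addl _ _) entry_le1.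
  have := band_le1 e Se neq_e; rewrite band_dropE //.
  exact: leq_trans (leq_addr _ _).
pose P := [set f : edge (snake_graph a) | snake_drop a 1 h (val f) == 0].
have hP e : e \in snake_grid_edges a -> has_edge P e + snake_drop a 1 h e = 1.
  move=> Se; rewrite -[e]/(val (SeqSub Se)) has_edge_val inE.
  by have := drop_le1 e Se; rewrite /=; case: (snake_drop a 1 h e) => [|[]].
have matchP : perfect_matching P.
  by apply/(snake_matching_heights P N_gt0); exists h.
have entry_or_exit : has_edge P entry_edge || has_edge P (exit_edge a).
  have := hP _ (entry_in N_gt0); have := hP _ (exit_in N_gt0).
  by move: entry_le1; do 2![case: has_edge] => //=; lia.
have -> : Q = matching_image P.
  apply/setP => e; have := imageP P h entry_or_exit hP e; have := hQ e.
  by case: (e \in Q); case: (e \in matching_image P); lia.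
apply/andP; split; first exact: matching_image_perfect.
by apply/existsP; exists P; rewrite matchP entry_or_exit /=.
Qed.

(** * The fence of tiles *)

(** The crossing edge [k + 1] makes heights increase from tile [k] to tile
    [k + 1]: it is a black-to-white side of tile [k + 1]. *)
Definition ascent (a : seq nat) (k : nat) : bool := dir a k.+1 (+) odd k.

(** [fence a i j] holds when an edge common to tiles [i] and [j] requires
    [h i <= h j]; the last case is that of the glued edge. *)
Definition fence (a : seq nat) (i j : nat) : bool :=
  [|| (j == i.+1) && ascent a i, (i == j.+1) && ~~ ascent a j |
      (i == 0) && (j.+1 == num_tiles a)].

(** The hypothesis on the last direction makes the glued edge a black-to-white
    side of the last tile; it is a white-to-black side of the first one. *)
Lemma band_drop_le (a : seq nat) (m : nat) (h : nat -> nat) :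
  1 < num_tiles a -> dir a (num_tiles a) = ~~ odd (num_tiles a) ->
  (forall k, h k <= m) ->
  (forall e : edge (band_graph a), band_drop a m h (val e) <= m) <->
  (forall i j, i < num_tiles a -> j < num_tiles a -> fence a i j -> h i <= h j).
Proof.
move=> N_gt1 dirN h_le; have N_gt0 := ltnW N_gt1.
have weight_le k d : side_weight m h k d <= m.
  by rewrite /side_weight; case: ifP => _ //; apply: leq_subr.
have crossing_neq k : k < num_tiles a -> crossing_edge a k != exit_edge a.
  by move=> ltk; rewrite exit_crossing // xpair_eqE eq_tile (ltn_eqF ltk).
have crossing_drop k : k.+1 < num_tiles a ->
    band_drop a m h (crossing_edge a k.+1) =
    if ascent a k then m - h k.+1 + h k else h k.+1 + (m - h k).
  move=> ltk; rewrite band_dropE ?crossing_neq //.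
  rewrite (entry_crossing a) xpair_eqE eq_tile /= addn0 snake_drop_crossing.
  rewrite ltk (ltnW ltk) /side_weight /ascent /=.
  by case: (dir a _); case: odd.
have entry_drop : band_drop a m h entry_edge = h 0 + (m - h (num_tiles a).-1).
  rewrite band_dropE ?entry_neq_exit // eqxx exit_crossing //.
  rewrite (entry_crossing a).
  rewrite !snake_drop_crossing N_gt0 ltnn addn0 add0n.
  case DN: (num_tiles a) => [|N]; first by rewrite DN in N_gt0.
  rewrite leqnn -DN dirN DN /side_weight /= negbK.
  by case: odd.
split=> [drop_le i j lti ltj|h_mono e].
  case/or3P=> /andP[/eqP D].
  - rewrite D in ltj *; move=> up.
    have [f Df] := band_edge_of N_gt0 (crossing_edge_in N_gt0 (ltnW ltj))
      (crossing_neq _ ltj).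
    have := drop_le f; rewrite Df crossing_drop // up.
    have := h_le i; have := h_le i.+1; lia.
  - rewrite D in lti *; move=> up.
    have [f Df] := band_edge_of N_gt0 (crossing_edge_in N_gt0 (ltnW lti))
      (crossing_neq _ lti).
    have := drop_le f; rewrite Df crossing_drop // (negbTE up).
    have := h_le j; have := h_le j.+1; lia.
  rewrite D => /eqP Dj; have [|f Df] := band_edge_of N_gt0 (entry_in N_gt0).
    by rewrite entry_neq_exit.
  have := drop_le f; rewrite Df entry_drop -Dj /=.
  have := h_le 0; have := h_le j; lia.
have := valP e; rewrite band_edgeP // => /andP[/snake_edge_specP].
case=> k ltk neq_e.
- rewrite band_dropE // snake_drop_lower // (entry_crossing a) xpair_eqE.
  by rewrite eq_tile; case: eqP => [->|_]; rewrite ?eq_dirNr /= addn0.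
- rewrite band_dropE // snake_drop_upper // (entry_crossing a) xpair_eqE.
  by rewrite step_eq_tile /= addn0.
case: k ltk neq_e => [|k] ltk neq_e.
  rewrite -(entry_crossing a) entry_drop.
  have ltN : (num_tiles a).-1 < num_tiles a by rewrite ltn_predL.
  have := h_mono 0 _ N_gt0 ltN; rewrite /fence (prednK N_gt0) !eqxx !orbT.
  move=> /(_ isT); have := h_le 0; have := h_le (num_tiles a).-1; lia.
have lt_k : k.+1 < num_tiles a.
  rewrite ltn_neqAle ltk andbT; apply: contraNneq neq_e => ->.
  by rewrite exit_crossing.
rewrite crossing_drop //; case: ifP => up.
  have := h_mono k k.+1 (ltnW lt_k) lt_k; rewrite /fence eqxx up /= => /(_ isT).
  have := h_le k; have := h_le k.+1; lia.
have := h_mono k.+1 k lt_k (ltnW lt_k).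
rewrite /fence eqxx up /= orbT => /(_ isT).
have := h_le k; have := h_le k.+1; lia.
Qed.

(** * Good covers *)

Lemma band_drop_sum (a : seq nat) (m : nat) (h : 'I_m -> nat -> nat)
    (e : grid_edge) : (forall j k, h j k <= 1) ->
  band_drop a m (fun k => \sum_(j < m) h j k) e =
  \sum_(j < m) band_drop a 1 (h j) e.
Proof.
move=> h_le1; rewrite /band_drop exchange_big /=; apply: eq_bigr => k _.
rewrite big_split -!big_distrr /= sumnB; last by move=> j _; apply: h_le1.
by rewrite sum_nat_const card_ord muln1.
Qed.

(** Heights of the summands add up to heights of the cover.  Conversely, given
    heights [h], the [j]-th summand has the tiles [k] with [j < h k] flipped up;
    these threshold functions are monotone for the fence because [h] is, so
    each one comes from a good matching. *)
Lemma good_coverP (a : seq nat) (m : nat) (M : edge_multiset a) :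
  1 < num_tiles a -> dir a (num_tiles a) = ~~ odd (num_tiles a) ->
  is_good_cover m M <->
  exists2 h : nat -> nat, forall k, h k <= m &
    forall e : edge (band_graph a), M e + band_drop a m h (val e) = m.
Proof.
move=> N_gt1 dirN; split=> [|[h h_le hM]].
  case/existsP=> Q /andP[/forallP goodQ /forallP DM].
  have heights i : exists h : nat -> nat, (forall k, h k <= 1) /\
      forall e : edge (band_graph a), (e \in Q i) + band_drop a 1 h (val e) = 1.
    by have [h] := proj1 (good_matchingP (Q i) N_gt1) (goodQ i); exists h.
  have [h hP] := fin_all_exists heights.
  exists (fun k => \sum_(i < m) h i k) => [k|e].
    rewrite -[leqRHS]card_ord -[leqRHS]muln1 -sum_nat_const.
    by apply: leq_sum => i _; have [] := hP i.
  rewrite band_drop_sum => [|i k]; last by have [] := hP i.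
  rewrite (eqP (DM e)) -big_split /= -[RHS]card_ord -[RHS]muln1 -sum_nat_const.
  by apply: eq_bigr => i _; have [_ ->] := hP i.
pose t (j : 'I_m) k : nat := j < h k.
have t_le1 j k : t j k <= 1 by apply: leq_b1.
have sum_t k : \sum_(j < m) t j k = h k.
  by rewrite -big_mkcond (big_ord_narrow (h_le k)) sum1_card card_ord.
have t_drop j :
    forall e : edge (band_graph a), band_drop a 1 (t j) (val e) <= 1.
  apply/band_drop_le => // i k lti ltk fence_ik.
  have drop_le (e : edge (band_graph a)) : band_drop a m h (val e) <= m.
    by rewrite -[leqRHS](hM e) leq_addl.
  have := proj1 (band_drop_le N_gt1 dirN h_le) drop_le i k lti ltk fence_ik.
  by rewrite /t; case: ltnP => // lt_i /(leq_trans lt_i) ->.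
pose Q := [ffun j =>
  [set e : edge (band_graph a) | band_drop a 1 (t j) (val e) == 0]].
have QE j (e : edge (band_graph a)) :
    (e \in Q j) + band_drop a 1 (t j) (val e) = 1.
  by rewrite ffunE inE; have := t_drop j e; case: band_drop => [|[]].
apply/existsP; exists Q; apply/andP; split.
  apply/forallP => j; apply/(good_matchingP _ N_gt1).
  by exists (t j); [apply: t_le1|apply: QE].
apply/forallP => e.
rewrite -(eqn_add2r (band_drop a m h (val e))) hM.
have -> : band_drop a m h (val e) = \sum_(j < m) band_drop a 1 (t j) (val e).
  rewrite -band_drop_sum // /band_drop.
  by apply: eq_bigr => k _; rewrite sum_t.
rewrite -big_split /= (eq_bigr (fun=> 1)) => [|j _]; last exact: QE.
by rewrite sum_nat_const card_ord muln1.
Qed.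

(** * Up-flips *)

Lemma sides_disjoint (a : seq nat) (k : nat) (e : grid_edge) :
  1 < num_tiles a -> k < num_tiles a ->
  up_side a k e -> down_side a k e = false.
Proof.
move=> N_gt1 ltk; rewrite /up_side /down_side !mem_glue; try exact: ltnW.
rewrite !mem_black_to_white !mem_white_to_black exit_sides //.
have [->|_] := eqVneq e entry_edge.
  rewrite entry_sides; have [->|_] := eqVneq k 0.
    by rewrite (ltn_eqF N_gt1) !andbF !orbF; case: (_ (+) _); rewrite ?andbF.
  by rewrite !andbF /=; case: (_ == _) => //=; case: (_ (+) _).
by rewrite !orbF; case: (_ (+) _); rewrite ?andbF.
Qed.

Lemma band_drop_raise (a : seq nat) (m : nat) (h h' : nat -> nat) (i : nat)
    (e : grid_edge) :
  i < num_tiles a -> (forall k, h' k <= m) ->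
  (forall k, k < num_tiles a -> h' k = h k + (k == i)) ->
  band_drop a m h' e + up_side a i e = band_drop a m h e + down_side a i e.
Proof.
move=> lti h'_le Dh'; rewrite /band_drop.
rewrite [in RHS](bigD1 (Ordinal lti)) //= (bigD1 (Ordinal lti)) //=.
rewrite (eq_bigr (fun k : 'I_(num_tiles a) =>
   up_side a k e * (m - h k) + down_side a k e * h k)) => [|k neq_k].
  have := h'_le i; rewrite (Dh' _ lti) eqxx /=; move: (\sum_(_ < _ | _) _) => S.
  by case: up_side; case: down_side; lia.
by rewrite Dh' // -[_ == i]/(k == Ordinal lti) (negbTE neq_k) addn0.
Qed.

Lemma band_drop_lower (a : seq nat) (m : nat) (h : nat -> nat) (k : nat) :
  1 < num_tiles a -> k < num_tiles a ->
  band_drop a m h (lower_edge a k) = side_weight m h k (dir a k).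
Proof.
move=> N_gt1 ltk; rewrite band_dropE //.
  rewrite snake_drop_lower // (entry_crossing a) xpair_eqE eq_tile.
  by case: eqP => [->|_]; rewrite ?eq_dirNr addn0.
by rewrite exit_crossing ?(ltnW N_gt1) // xpair_eqE eq_tile (ltn_eqF ltk).
Qed.

Lemma lower_edge_band (a : seq nat) (k : nat) :
  1 < num_tiles a -> k < num_tiles a ->
  exists e : edge (band_graph a), val e = lower_edge a k.
Proof.
move=> N_gt1 ltk; have N_gt0 := ltnW N_gt1.
apply: band_edge_of; rewrite ?lower_edge_in // exit_crossing // xpair_eqE.
by rewrite eq_tile (ltn_eqF ltk).
Qed.

Lemma up_side_lower (a : seq nat) (i k : nat) :
  1 < num_tiles a -> i < num_tiles a -> k < num_tiles a ->
  (up_side a i (lower_edge a k) = (i == k) && (dir a k (+) odd k)) *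
  (down_side a i (lower_edge a k) = (i == k) && ~~ (dir a k (+) odd k)).
Proof.
move=> N_gt1 lti ltk; have N_gt0 := ltnW N_gt1.
have neq_exit : lower_edge a k != exit_edge a.
  by rewrite exit_crossing // xpair_eqE eq_tile (ltn_eqF ltk).
have neq_entry : (lower_edge a k == entry_edge) = false.
  rewrite (entry_crossing a) xpair_eqE eq_tile.
  by case: eqP => [->|//]; rewrite eq_dirNr.
rewrite /up_side /down_side !mem_glue // neq_exit neq_entry !orbF.
rewrite mem_black_to_white mem_white_to_black !lower_edge_sides level_tile.
by case: eqP => [->|].
Qed.

(** The lower edge of each tile shows its height, so the effect of a flip on the
    lower edges determines the new heights.  Conversely the multiplicities of a
    cover with the raised heights differ by a flip; they are nonnegative after
    it, so the edges that it removes were present. *)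
Lemma up_flip_heights (a : seq nat) (m : nat) (M M' : edge_multiset a)
    (h h' : nat -> nat) (i : nat) :
  1 < num_tiles a -> i < num_tiles a ->
  (forall k, h k <= m) -> (forall k, h' k <= m) ->
  (forall e : edge (band_graph a), M e + band_drop a m h (val e) = m) ->
  (forall e : edge (band_graph a), M' e + band_drop a m h' (val e) = m) ->
  up_flip_around (tile a i) M M' <->
  (forall k, k < num_tiles a -> h' k = h k + (k == i)).
Proof.
move=> N_gt1 lti h_le h'_le hM hM'.
split=> [/andP[/forallP downP /forallP DM'] k ltk|Dh'].
  have [e De] := lower_edge_band N_gt1 ltk.
  have := eqP (DM' e); have := implyP (downP e); have := hM e; have := hM' e.
  rewrite De !band_drop_lower // -/(up_side a i _) -/(down_side a i _).
  rewrite !up_side_lower // /side_weight (eq_sym i).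
  have := h_le k; have := h'_le k.
  case: (dir a k (+) odd k); case: (k == i) => /= le_h' le_h E' E le_M;
    by first [lia|have := le_M isT; lia].
have M'E e : M' e + down_side a i (val e) = M e + up_side a i (val e).
  have aux (x x' b b' u d : nat) :
      x' + b' = m -> x + b = m -> b' + u = b + d -> x' + d = x + u by lia.
  exact: aux (hM' e) (hM e) (band_drop_raise (val e) lti h'_le Dh').
apply/andP; split; apply/forallP=> e; have := M'E e;
  rewrite -/(up_side a i _) -/(down_side a i _);
  have := @sides_disjoint a i (val e) N_gt1 lti; case: up_side.
- by move=> ->.
- by move=> _; case: down_side => //=; rewrite addn0 addn1 => <-.
- by move=> -> //; rewrite addn0 subn0 => ->.
by move=> _; rewrite !addn0 => <-; rewrite addnK.
Qed.

(** * The fence has no cycle *)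

(** Directions alternate except at block ends. *)
Lemma dirE (a : seq nat) (i : nat) :
  dir a i = ~~ odd (i + count (mem (block_ends a)) (iota 1 i)).
Proof.
elim: i => // i IHi.
rewrite -[X in iota 1 X]addn1 iotaD count_cat /= add1n addn0.
rewrite -[dir _ _]/(if i.+1 \in block_ends a then dir a i else ~~ dir a i) IHi.
by case: (i.+1 \in block_ends a); rewrite ?addn0 ?addn1 ?addnS ?addSn //= negbK.
Qed.

Lemma block_ends_sorted (x : nat) (s : seq nat) :
  all (leq 1) s -> path ltn x (scanl addn x s).
Proof.
elim: s x => //= y s IHs x /andP[y_gt0 s_gt0]; rewrite IHs // andbT.
by rewrite -addn1 leq_add2l.
Qed.

Lemma block_ends_le (x : nat) (s : seq nat) :
  {in scanl addn x s, forall y, y <= x + sumn s}.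
Proof.
elim: s x => //= y s IHs x z; rewrite inE addnA => /predU1P[->|/IHs //].
exact: leq_addr.
Qed.

Lemma count_block_ends (a : seq nat) : all (leq 1) a ->
  count (mem (block_ends a)) (iota 1 (num_tiles a)) = size a.
Proof.
move=> a_gt0; rewrite -size_filter -(size_scanl addn 0 a).
have sorted_ends := block_ends_sorted 0 a_gt0.
apply/perm_size/uniq_perm; first by rewrite filter_uniq ?iota_uniq.
  exact: sorted_uniq ltn_trans ltnn _ (path_sorted sorted_ends).
move=> y; rewrite mem_filter mem_iota andb_idr // => end_y.
have /allP/(_ _ end_y) /= -> := order_path_min ltn_trans sorted_ends.
by rewrite add1n ltnS; have := @block_ends_le 0 a y end_y; rewrite add0n.
Qed.

Lemma dir_last (a : seq nat) : all (leq 1) a -> ~~ odd (size a) ->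
  dir a (num_tiles a) = ~~ odd (num_tiles a).
Proof.
move=> a_gt0 /negbTE even_a.
by rewrite dirE count_block_ends // oddD even_a addbF.
Qed.

(** Directions alternate inside the first block, so all steps there are
    descents; the step out of it is the first ascent. *)
Lemma first_ascent (x y : nat) (s : seq nat) (a := [:: x, y & s]) :
  all (leq 1) a -> exists2 k, k.+1 < num_tiles a & ascent a k.
Proof.
case: x @a => // k a /= /andP[y_gt0 s_gt0]; exists k.
  by rewrite /num_tiles /= -addn1 leq_add2l (leq_trans y_gt0) ?leq_addr.
rewrite /ascent.
rewrite -[dir _ _]/(if k.+1 \in block_ends a then dir a k else ~~ dir a k).
rewrite /block_ends /= add0n inE eqxx /= dirE.
rewrite (_ : count _ _ = 0); first by rewrite addn0; case: odd.
apply/eqP; rewrite -leqn0 leqNgt -has_count; apply/hasPn => z.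
rewrite mem_iota => /andP[_ ltz]; rewrite /block_ends /= add0n.
have sorted_ends : path ltn k.+1 (scanl addn k.+1 (y :: s)).
  by apply: block_ends_sorted; rewrite /= y_gt0.
have /allP min_ends := order_path_min ltn_trans sorted_ends.
apply/negP; rewrite in_cons => /predU1P[Dz|/min_ends /=]; lia.
Qed.

(** Each ascent gains [num_tiles a] and each descent loses [1].  There are too
    few descents to cancel one ascent, so the last tile has a larger rank than
    the first one as soon as there is an ascent. *)
Definition fence_rank (a : seq nat) (k : nat) : nat :=
  (num_tiles a).+1 * count (ascent a) (iota 0 k) +
  (num_tiles a - k).

Lemma fence_rankP (a : seq nat) (i j : nat) :
  (exists2 k, k.+1 < num_tiles a & ascent a k) ->
  i < num_tiles a -> j < num_tiles a -> fence a i j ->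
  fence_rank a i < fence_rank a j.
Proof.
case=> k ltk ascent_k lti ltj; rewrite /fence_rank.
have countS l : count (ascent a) (iota 0 l.+1) =
    count (ascent a) (iota 0 l) + ascent a l.
  by rewrite -[X in iota 0 X]addn1 iotaD count_cat /= add0n addn0.
case/or3P=> /andP[/eqP D].
- by rewrite D => up; rewrite countS up mulnDr muln1; lia.
- by rewrite D => /negbTE up; rewrite countS up addn0; lia.
rewrite D /= muln0 add0n subn0 => /eqP Dj.
have : 0 < count (ascent a) (iota 0 j).
  rewrite -has_count; apply/hasP; exists k => //.
  by rewrite mem_iota add0n leq0n /=; lia.
by case: count => // c _; rewrite mulnS; lia.
Qed.

(** * The lattice of good covers *)

(** Extends heights to all naturals; outside the tiles only the bound [m]
    matters. *)
Definition nat_heights (N m : nat) (g : {ffun 'I_N -> 'I_m.+1}) (k : nat) :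
    nat :=
  oapp (fun i => g i : nat) 0 (insub k).

Lemma nat_heightsE (N m : nat) (g : {ffun 'I_N -> 'I_m.+1}) (k : 'I_N) :
  nat_heights g k = g k.
Proof. by rewrite /nat_heights valK. Qed.

Lemma nat_heights_le (N m : nat) (g : {ffun 'I_N -> 'I_m.+1}) (k : nat) :
  nat_heights g k <= m.
Proof. by rewrite /nat_heights; case: insub => //= i; rewrite -ltnS. Qed.

Lemma eq_band_drop (a : seq nat) (m : nat) (h h' : nat -> nat) (e : grid_edge) :
  (forall k, k < num_tiles a -> h k = h' k) ->
  band_drop a m h e = band_drop a m h' e.
Proof. by move=> eq_h; apply: eq_bigr => k _; rewrite eq_h. Qed.

Lemma good_cover_lattice (a : seq nat) (m : nat) :
  1 < num_tiles a -> dir a (num_tiles a) = ~~ odd (num_tiles a) ->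
  (exists2 k, k.+1 < num_tiles a & ascent a k) ->
  is_cover_relation (@flip_le a m) (@up_flip a m) /\
  is_distributive_lattice (@flip_le a m).
Proof.
move=> N_gt1 dirN ascent_a; pose N := num_tiles a.
pose R (i j : 'I_N) := fence a i j.
pose T : choiceType :=
  {M : {ffun edge (band_graph a) -> nat} | @is_good_cover a m M}.
pose heights_of (M : T) (g : monotone_map R m) :=
  [forall e, val M e + band_drop a m (nat_heights (val g)) (val e) == m].
have heights_ofP M g : heights_of M g ->
    forall e, val M e + band_drop a m (nat_heights (val g)) (val e) = m.
  by move=> /forallP Mg e; apply/eqP.
have raiseP M M' g g' (i : 'I_N) : heights_of M g -> heights_of M' g' ->
    up_flip_around (tile a i) (val M) (val M') <->
    (forall k, val g' k = val g k + (k == i) :> nat).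
  move=> /heights_ofP Mg /heights_ofP Mg'.
  have flipP := up_flip_heights N_gt1 (ltn_ord i) (nat_heights_le (val g))
    (nat_heights_le (val g')) Mg Mg'.
  split=> [/flipP Dg' k|Dg'].
    by have := Dg' k (ltn_ord k); rewrite !nat_heightsE.
  by apply/flipP => k ltk; have := Dg' (Ordinal ltk); rewrite -!nat_heightsE.
have ex_heights M : exists g, heights_of M g.
  have [h h_le hM] := proj1 (good_coverP m (val M) N_gt1 dirN) (valP M).
  pose g := [ffun k : 'I_N => inord (h k) : 'I_m.+1].
  have gE (k : 'I_N) : g k = h k :> nat by rewrite ffunE inordK // ltnS.
  have mono_g : is_monotone R g.
    apply/monotone_mapP => i j Rij; rewrite !gE.
    apply: (proj1 (band_drop_le N_gt1 dirN h_le)) Rij => // e.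
    by rewrite -[leqRHS](hM e) leq_addl.
  exists (Sub g mono_g); apply/forallP => e; rewrite -[eqbRHS](hM e) eqn_add2l.
  apply/eqP/eq_band_drop => k ltk.
  by rewrite -[k]/(val (Ordinal ltk)) nat_heightsE gE.
pose heights M := xchoose (ex_heights M).
have heightsP M : heights_of M (heights M) := xchooseP (ex_heights M).
have heights_uniq M g g' : heights_of M g -> heights_of M g' -> g = g'.
  move=> /heights_ofP Mg /heights_ofP Mg'; apply: monotone_map_eqP => k.
  have [e De] := lower_edge_band N_gt1 (ltn_ord k).
  have aux (b : bool) (c x y : nat) : x <= m -> y <= m ->
      c + (if b then m - x else x) = m ->
      c + (if b then m - y else y) = m -> x = y.
    by case: b; lia.
  have := Mg e; have := Mg' e; rewrite De !band_drop_lower // /side_weight.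
  rewrite !nat_heightsE => E' E; apply/val_inj/(aux _ _ _ _ _ _ E E');
    by rewrite -ltnS.
apply: (@raise_lattice T (@up_flip a m) _ R m (fence_rank a) heights).
- by move=> i j; apply: fence_rankP.
- move=> M M' eq_h; apply/val_inj/ffunP => e.
  have DM := heights_ofP _ _ (heightsP M) e.
  by have := heights_ofP _ _ (heightsP M') e; rewrite -eq_h -[RHS]DM => /addIn.
- move=> g; have g_le := nat_heights_le (val g).
  have drop_le : forall e : edge (band_graph a),
      band_drop a m (nat_heights (val g)) (val e) <= m.
    apply/(band_drop_le N_gt1 dirN g_le) => i j lti ltj fence_ij.
    have := monotone_mapP _ _ (valP g) (Ordinal lti) (Ordinal ltj) fence_ij.
    by rewrite -!nat_heightsE.
  pose M := [ffun e : edge (band_graph a) =>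
    m - band_drop a m (nat_heights (val g)) (val e)].
  have ME e : M e + band_drop a m (nat_heights (val g)) (val e) = m.
    by rewrite ffunE subnK.
  have goodM : is_good_cover m M.
    by apply/(good_coverP m M N_gt1 dirN); exists (nat_heights (val g)).
  exists (Sub M goodM); apply: heights_uniq (heightsP _) _.
  by apply/forallP => e; rewrite SubK ME.
move=> M M'; split=> [/hasP[p /mapP[i]]|[i Dh]].
  rewrite mem_iota => lti -> flip_i; exists (Ordinal lti).
  exact/(raiseP M M').
apply/hasP; exists (tile a i); last first.
  exact/(raiseP M M' (heights M) (heights M')).
by apply: map_f; rewrite mem_iota add0n leq0n ltn_ord.
Qed.

Theorem proposition3p3 (m n : nat) (m_ge1 : 1 <= m) (n_ge1 : 1 <= n)
    (a : (2 * n).-tuple nat) (a_ge1 : forall i : 'I_(2 * n), 1 <= tnth a i) :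
  is_cover_relation (@flip_le a m) (@up_flip a m) /\
  is_distributive_lattice (@flip_le a m).
Proof.
have a_gt0 : all (leq 1) a by apply/all_tnthP.
have size_a := size_tuple a.
have [x [y [s Da]]] : exists x y s, tval a = [:: x, y & s].
  case: (tval a) size_a => [|x [|y s]] /=; [lia|lia|by exists x, y, s].
have ascent_a : exists2 k, k.+1 < num_tiles a & ascent a k.
  by rewrite Da; apply: first_ascent; rewrite -Da.
have [k ltk _] := ascent_a.
apply: good_cover_lattice => //; first exact: leq_trans ltk.
by apply: dir_last => //; rewrite size_a mul2n odd_double.
Qed.
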